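(* Let $q$ be a prime power with $q\equiv 2\pmod 3$, and let $\mathcal{F}_q$ be the 1-factorisation of $K_{q+1}^3$ defined in the context. Then $\mathcal{F}_q$ is a uniform 1-factorisation if and only if $q\in\{2,5,8\}$, and in these cases it is a uniform-connected 1-factorisation.
   Context: Let $q$ be a prime power with $q\equiv 2\pmod 3$, let $\mathbb{F}=\mathbb{F}_q$ be the field of order $q$, $\mathbb{F}^*=\mathbb{F}\setminus\{0\}$, and $V=\mathbb{F}\cup\{\infty\}$. $K_{q+1}^3$ denotes the complete 3-uniform hypergraph on the vertex set $V$: its edges are all 3-element subsets of $V$. A 1-factor of a hypergraph is a spanning 1-regular subhypergraph (i.e. a set of edges partitioning the vertex set); a 1-factorisation is a partition of the edge set into 1-factors. For $\alpha\in\mathbb{F}^*$, $\beta\in\mathbb{F}$ define $m_{\alpha,\beta}:V\to V$ by $m_{\alpha,\beta}(x)=\beta+\frac{\alpha^2}{\alpha+\beta-x}$ for $x\in\mathbb{F}\setminus\{\alpha+\beta\}$, $m_{\alpha,\beta}(\alpha+\beta)=\infty$, $m_{\alpha,\beta}(\infty)=\beta$. Each $m_{\alpha,\beta}$ is a fixed-point-free permutation of $V$ of order 3. Set $F_{\alpha,\beta}=\{\{x,m_{\alpha,\beta}(x),m_{\alpha,\beta}^{-1}(x)\}\mid x\in V\}$, which is a 1-factor of $K_{q+1}^3$, and $\mathcal{F}_q=\{F_{\alpha,\beta}\mid \alpha\in\mathbb{F}^*,\ \beta\in\mathbb{F}\}$ (as a set, so that coinciding 1-factors are counted once; in fact $F_{\alpha,\beta}=F_{-\alpha,\alpha+\beta}$).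 It is known (Chen and Lu) that $\mathcal{F}_q$ is a 1-factorisation of $K_{q+1}^3$ (for $q=2$ it is the trivial one, with a single 1-factor). A path between vertices $x,y$ of a hypergraph is an alternating sequence $[x=v_1,e_1,v_2,\dots,v_s,e_s,v_{s+1}=y]$ of distinct vertices $v_i$ and distinct edges $e_i$ with $\{v_i,v_{i+1}\}\subseteq e_i$ for $1\le i\le s$. A hypergraph is connected if every two vertices have a path between them. The union of two 1-factors is the hypergraph on $V$ whose edges are those of the two 1-factors. A uniform 1-factorisation is a 1-factorisation for which the unions of pairs of distinct 1-factors are all isomorphic to the same hypergraph, called the common hypergraph. A uniform-connected 1-factorisation is a uniform 1-factorisation in which the common hypergraph is connected, i.e. in which the union of each pair of distinct 1-factors is connected. (For $q=2$ there is only one 1-factor, and these conditions hold vacuously.) *)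

(* Defs.v *)
From mathcomp Require Import all_boot all_order all_fingroup all_algebra.

Set Implicit Arguments.
Unset Strict Implicit.
Unset Printing Implicit Defensive.

Import GRing.Theory.
Local Open Scope ring_scope.

(* A hypergraph on the vertex set T is given by its set of edges; every element
   of T is a vertex, whether or not it is covered by an edge. *)
Definition hypergraph (T : finType) := {set {set T}}.

Section Hypergraphs.

Variable T : finType.
Implicit Types (H M : hypergraph T) (C : {set hypergraph T}).

Definition complete3 : hypergraph T := [set e : {set T} | #|e| == 3%N].

Definition one_factor H M : bool := (M \subset H) && partition M [set: T].

Definition one_factorisation H C : bool :=
  partition C H && [forall M in C, one_factor H M].

Definition hyper_iso H1 H2 : Prop :=
  exists f : {perm T}, [set f @: (e : {set T}) | e in H1] = H2.

(* The path [v_1, e_1, v_2, ..., e_s, v_(s+1)] is encoded by its first vertex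
   v_1 and the sequence [:: (e_1, v_2); ...; (e_s, v_(s+1))]. *)
Fixpoint hyper_walk H (x : T) (p : seq ({set T} * T)) : bool :=
  if p is (e, y) :: p' then
    [&& e \in H, [set x; y] \subset e & hyper_walk H y p']
  else true.

Definition hyper_path H (x y : T) (p : seq ({set T} * T)) : bool :=
  [&& hyper_walk H x p, uniq (x :: unzip2 p), uniq (unzip1 p)
    & last x (unzip2 p) == y].

Definition hyper_connected H : Prop :=
  forall x y : T, x != y -> exists p, hyper_path H x y p.

Definition uniform_one_factorisation H C : Prop :=
  one_factorisation H C /\
  exists U : hypergraph T,
    forall M1 M2, M1 \in C -> M2 \in C -> M1 != M2 -> hyper_iso (M1 :|: M2) U.

Definition uniform_connected_one_factorisation H C : Prop :=
  uniform_one_factorisation H C /\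
  forall M1 M2, M1 \in C -> M2 \in C -> M1 != M2 -> hyper_connected (M1 :|: M2).

End Hypergraphs.

Arguments complete3 T : clear implicits.

Section ChenLu.

Variable F : finFieldType.

(* V = F + {oo} is option F, with None standing for oo. *)
Definition mob (a b : F) (x : option F) : option F :=
  if x is Some y then
    if y == a + b then None else Some (b + a ^+ 2 / (a + b - y))
  else Some b.

(* Hence finv (mob a b) is the inverse permutation of mob a b. *)
Lemma mob_inj (a b : F) : a != 0 -> injective (mob a b).
Proof.
move=> a0.
have neq y : y != a + b -> b + a ^+ 2 / (a + b - y) != b.
  move=> ny; rewrite -subr_eq0 addrC addKr mulf_neq0 ?expf_neq0 //.
  by rewrite invr_eq0 subr_eq0 eq_sym.
move=> [x|] [y|] //=.
- case: eqP => [->|_]; case: eqP => [->|_] // [] /addrI.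
  by move/(mulfI (expf_neq0 2 a0))/invr_inj/addrI/oppr_inj=> ->.
- by case: eqP => // /eqP/neq/eqP nb [] /nb.
- by case: eqP => // /eqP/neq/eqP nb [] /esym/nb.
Qed.

Definition mob_factor (a b : F) : hypergraph (option F) :=
  [set [set x; mob a b x; finv (mob a b) x] | x : option F].

Definition mob_factorisation : {set hypergraph (option F)} :=
  [set mob_factor a b | a in [set~ (0 : F)], b in [set: F]].

End ChenLu.

(* Main.v *)
Require Import Defs.
From mathcomp Require Import all_boot all_order all_fingroup all_algebra.
From mathcomp Require Import all_solvable all_field ring zify.

Set Implicit Arguments.
Unset Strict Implicit.
Unset Printing Implicit Defensive.

Import GRing.Theory.

(** Every map [mob a b] is an element of order 3 of PGL(2, q).  Since q is 2
    modulo 3, the field has no primitive cube root of unity, hence such an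
    element fixes no point of F + oo and its orbits form a 1-factor.  Affine
    maps and the inversion permute these 1-factors and generate a group that
    is transitive on triples of points; the triple {oo, 0, 1} lies in the
    factor of [mob 1 0] and in no other, so every triple lies in exactly one
    factor ([mob_one_factorisation]).

    The number of ordered pairs of vertices lying in a common edge is an
    isomorphism invariant.  For the union of the factors of two maps m and m'
    it equals 4 (q + 1) - 2 c, where c counts the x with m x = m' x and the x
    with m' (m x) = x; in other words c is the number of pairs of edges, one
    in each factor, that share two vertices ([card_shadow_coincidences]).  In a
    uniform factorisation c is therefore constant.  It is enough to compare
    the factor of [mob 1 0] with its translates by b: there c is the number of
    roots of two quadratic polynomials, with discriminants b^2 + 4 and
    (b^2 - 1) (b^2 + 3).
    - In odd characteristic different from 5, c is odd for b = 1, where one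
      discriminant is 0 and the other is 5, and it is even for all but a few b.
    - In characteristic 5, c = 2 for b = 1, where both discriminants vanish.
      If b^2 + 3 is a square, the discriminants are both squares or both
      non-squares, because b^2 + 4 = b^2 - 1; then c is 4 or 0.
    - In characteristic 2, let H be the subgroup of elements u^2 + u, of index
      2 in F.  Then c = 2 ([1/b in H] + [1/(b + 1) in H]), and for q > 8 this
      can only be constant if 1/s is never in H for s in H, s <> 0.  An
      identity between inverses then bounds the order of H by 4
      ([inverse_closed_bound]).
    So uniformity forces q <= 8 ([uniform_bound]), that is q = 2, 5 or 8.

    Conversely, two distinct factors with edges sharing two vertices can be
    moved to the factors of [mob 1 0] and [mob y 0], y <> 0, 1
    ([adjacent_pair_iso]).  For q = 5 a factor consists of a triple and its
    complement, so such edges always exist, and exchanging two values of y is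
    an isomorphism.  For q = 8 such edges exist because an explicit quadratic
    has a root, and all the y are conjugate under the Frobenius map and
    y |-> 1/y.  For q = 2 there is a single factor.  Connectedness is a count:
    a component of the union is a union of triples of either factor, so if there
    were two components on at most nine vertices, one of them would be an edge
    common to both factors. *)

(** * Finite sets *)

Lemma exists_notin (T : finType) (A : {set T}) (s : seq T) :
  (size s < #|A|)%N -> exists2 x, x \in A & x \notin s.
Proof.
move=> sA; apply/exists_inP; apply: contraLR sA; rewrite negb_exists_in -leqNgt.
move=> /forall_inP As; apply: leq_trans (card_size s); apply: subset_leq_card.
by apply/subsetP=> x /As; rewrite negbK.
Qed.

Lemma card_setU2 (T : finType) (s t u v : T) : s != t -> u != v ->
  (#|[set s; t] :|: [set u; v]| + ((s == u) + (s == v) + (t == u) + (t == v)) = 4)%N.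
Proof.
move=> st uv; have := cardsUI [set s; t] [set u; v]; rewrite !cards2 st uv /= => UI.
have in_uv w : nat_of_bool (w \in [set u; v]) = ((w == u) + (w == v))%N.
  by rewrite !inE; have [->|_] := eqVneq w u; rewrite ?(negbTE uv).
rewrite -[RHS]UI -[in LHS](addnA _ (t == u)) -!in_uv; congr (_ + _)%N.
rewrite -sum1_card (eq_bigl _ _ (fun w => in_setI w _ _)) big_mkcondr /=.
by rewrite big_setU1 ?big_set1 ?inE //=; do 2!case: (_ \in _).
Qed.

(** * Hypergraphs: relabelling, adjacency and connectedness *)

Section HypergraphTheory.

Variable T : finType.
Implicit Types (H M : hypergraph T) (e f : {set T}) (g : {perm T}).

Definition hmap g H : hypergraph T := [set g @: (e : {set T}) | e in H].

Lemma hmapM g1 g2 H : hmap (g1 * g2)%g H = hmap g2 (hmap g1 H).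
Proof.
rewrite /hmap -imset_comp; apply: eq_imset => e /=.
by rewrite -imset_comp; apply: eq_imset => x /=; rewrite permM.
Qed.

Lemma hmap1 H : hmap 1%g H = H.
Proof.
rewrite /hmap -[RHS]imset_id; apply: eq_imset => e /=.
by rewrite -[RHS]imset_id; apply: eq_imset => x; rewrite perm1.
Qed.

Lemma hmap_inj g : injective (hmap g).
Proof. exact/imset_inj/imset_inj/perm_inj. Qed.

Lemma mem_hmap g H e : (g @: e \in hmap g H) = (e \in H).
Proof. by rewrite mem_imset //; apply/imset_inj/perm_inj. Qed.

Lemma hmapU g H1 H2 : hmap g (H1 :|: H2) = hmap g H1 :|: hmap g H2.
Proof. exact: imsetU. Qed.

Lemma hyper_iso_trans H1 H2 H3 :
  hyper_iso H1 H2 -> hyper_iso H2 H3 -> hyper_iso H1 H3.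
Proof. by move=> [g <-] [h <-]; exists (g * h)%g; exact: hmapM. Qed.

Lemma hyper_iso_refl H : hyper_iso H H.
Proof. by exists 1%g; exact: hmap1. Qed.

Definition adjacent H : rel T :=
  [rel x y | [exists e in H, (x \in e) && (y \in e)]].

(** The pairs of distinct adjacent vertices: its cardinal is the isomorphism
    invariant that separates the unions of pairs of 1-factors. *)
Definition shadow H : {set T * T} :=
  [set p | (p.1 != p.2) && adjacent H p.1 p.2].

Lemma adjacent_sym H : symmetric (adjacent H).
Proof. by move=> x y /=; apply: eq_existsb => e; rewrite [(x \in e) && _]andbC. Qed.

Lemma adjacentU H1 H2 x y :
  adjacent (H1 :|: H2) x y = adjacent H1 x y || adjacent H2 x y.
Proof.
apply/existsP/orP => [[e]|[] /existsP[e /andP[eH xye]]].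
- by rewrite inE => /andP[/orP[] eH xye]; [left|right]; apply/existsP; exists e; rewrite eH.
- by exists e; rewrite inE eH.
- by exists e; rewrite inE eH orbT.
Qed.

Lemma adjacent_hmap g H x y :
  adjacent (hmap g H) (g x) (g y) = adjacent H x y.
Proof.
apply/existsP/existsP => [[_ /andP[/imsetP[e eH ->]]]|[e /andP[eH xye]]].
  by rewrite !mem_imset; [|exact: perm_inj..] => xye; exists e; rewrite eH.
by exists (g @: e); rewrite mem_hmap eH !mem_imset //; exact: perm_inj.
Qed.

Lemma card_shadow H :
  #|shadow H| = (\sum_x #|[set y | (x != y) && adjacent H x y]|)%N.
Proof.
rewrite -sum1_card (eq_bigl (fun p => (p.1 != p.2) && adjacent H p.1 p.2)); last first.
  by move=> p; rewrite inE.
rewrite -(pair_big_dep xpredT (fun x y => (x != y) && adjacent H x y) (fun _ _ => 1%N)) /=.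
by apply: eq_bigr => x _; rewrite -sum1_card; apply: eq_bigl => y; rewrite inE.
Qed.

Lemma card_shadow_hmap g H : #|shadow (hmap g H)| = #|shadow H|.
Proof.
have inj_gg : injective (fun p : T * T => (g p.1, g p.2)).
  by move=> [x y] [x' y'] [/perm_inj -> /perm_inj ->].
rewrite -(card_imset (mem (shadow H)) inj_gg); congr #|pred_of_set _|.
apply/setP => -[x y]; rewrite -[x](permKV g) -[y](permKV g).
rewrite (mem_imset _ (_, _) inj_gg) !inE /= (inj_eq perm_inj).
by rewrite -[in RHS](adjacent_hmap g).
Qed.

Lemma hyper_path_suffix H x y p1 e z p2 :
    hyper_path H x y (p1 ++ (e, z) :: p2) ->
  [/\ e \in H, z \in e, e \notin unzip1 p2 & hyper_path H z y p2].
Proof.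
rewrite /hyper_path /unzip1 /unzip2 map_cat -cat_cons map_cat !cat_uniq last_cat /=.
case/and4P=> + /and3P[_ _ Uv] /and3P[_ _ /andP[e'p2 Ue]] last_p.
suff: hyper_walk H x (p1 ++ (e, z) :: p2) ->
  [/\ e \in H, z \in e & hyper_walk H z p2].
  by move=> /[apply] -[eH ze wz]; split=> //; apply/and4P; split.
elim: p1 x {last_p} => [|[f t] p1 IH] x /=; last by case/and3P=> _ _ /IH.
by case/and3P=> -> + ->; rewrite subUset !sub1set => /andP[_ ->].
Qed.

(** A walk is shortened from its end: a vertex or an edge that occurs again
    later allows the part in between to be skipped. *)
Lemma hyper_walk_path H x y p :
    hyper_walk H x p -> last x (unzip2 p) = y ->
  exists q, hyper_path H x y q.
Proof.
elim: p x => [|[e z] p IH] x /=.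
  by move=> _ ->; exists [::]; rewrite /hyper_path /= eqxx.
case/and3P=> eH xze walk_p last_p; have [q path_q] := IH _ walk_p last_p.
have [->|x'z] := eqVneq x z; first by exists q.
have [/mapP[[f w] /path.splitPr Dq /= Dx]|x'q] := boolP (x \in unzip2 q).
  (* the path comes back to x: keep only what follows that visit *)
  case: Dq path_q => p1 p2 /hyper_path_suffix[_ _ _]; rewrite -Dx.
  by exists p2.
have [/mapP[[f w] /path.splitPr Dq /= De]|e'q] := boolP (e \in unzip1 q).
  (* the edge e is used again later: go along it directly to the later exit *)
  case: Dq path_q x'q => p1 p2 /hyper_path_suffix[_]; rewrite -De => we e'p2.
  case/and4P=> walk_q Uv Ue last_q; rewrite /unzip2 map_cat mem_cat negb_or.
  case/andP=> _ x'wq; exists ((e, w) :: p2); apply/and4P; split=> //=.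
  - rewrite eH walk_q andbT subUset !sub1set we andbT.
    by apply: (subsetP xze); rewrite !inE eqxx.
  - by rewrite x'wq.
  - by rewrite e'p2.
case/and4P: path_q => walk_q Uv Ue last_q.
exists ((e, z) :: q); apply/and4P; split=> //=.
- by rewrite eH xze.
- by rewrite inE negb_or x'z x'q.
- by rewrite e'q.
Qed.

Lemma connect_hyper_connected H :
  (forall x y, connect (adjacent H) x y) -> hyper_connected H.
Proof.
move=> conn x y _; have /connectP[s path_s ->] := conn x y.
suff [p walk_p last_p] : exists2 p, hyper_walk H x p & last x (unzip2 p) = last x s.
  exact: hyper_walk_path walk_p last_p.
elim: s x path_s => [|z s IH] x /=; first by exists [::].
case/andP=> /existsP[e /and3P[eH xe ze]] /IH[p walk_p last_p].
by exists ((e, z) :: p); rewrite //= eH walk_p subUset !sub1set xe ze.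
Qed.

(** A union of components is a union of blocks of each factor.  If it is a
    single block then the two factors share that block; otherwise it has at
    least six vertices, and two disjoint ones do not fit in nine vertices. *)
Lemma small_union_connected M1 M2 :
    one_factor (complete3 T) M1 -> one_factor (complete3 T) M2 ->
    (#|T| <= 9)%N -> [disjoint M1 & M2] ->
  hyper_connected (M1 :|: M2).
Proof.
move=> fM1 fM2 T9 dM12; set H := M1 :|: M2.
apply: connect_hyper_connected => x y; apply: contraT => not_conn.
have H_sym : connect_sym (adjacent H) by apply: sym_connect_sym; exact: adjacent_sym.
have big z : (5 < #|[set t | connect (adjacent H) z t]|)%N.
  set B := [set t | _].
  have block M t : M \subset H -> one_factor (complete3 T) M -> t \in B ->
      exists2 e, e \in M & [/\ t \in e, #|e| = 3 & e \subset B].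
    move=> MH /andP[M3 /and3P[/eqP covM _ _]]; rewrite inE => zt.
    have /bigcupP[e eM te] : t \in cover M by rewrite covM inE.
    exists e => //; split=> //.
      by have := subsetP M3 e eM; rewrite inE => /eqP.
    apply/subsetP=> u ue; rewrite inE (connect_trans zt) // connect1 //.
    by apply/existsP; exists e; rewrite (subsetP MH) ?te ?ue.
  have zB : z \in B by rewrite inE connect0.
  have [e eM1 [_ e3 eB]] := block M1 z (subsetUl _ _) fM1 zB.
  have [f fM2' [_ f3 fB]] := block M2 z (subsetUr _ _) fM2 zB.
  rewrite ltnNge; apply/negP=> B5.
  have full M k : M \subset H -> one_factor (complete3 T) M -> k \in M ->
      #|k| = 3 -> k \subset B -> B = k.
    move=> MH fM kM k3 kB; apply/eqP; rewrite eqEsubset kB andbT.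
    apply/subsetP=> t tB; apply: contraT => t'k.
    have [k' k'M [tk' k'3 k'B]] := block M t MH fM tB.
    have neq_k : k != k' by apply: contraNneq t'k => ->.
    have dk : [disjoint k & k'].
      by case/andP: fM => _ /and3P[_ /trivIsetP trM _]; exact: trM.
    have : (#|k :|: k'| <= #|B|)%N by rewrite subset_leq_card // subUset kB.
    have kk' : k :&: k' = set0 by apply/eqP; rewrite setI_eq0.
    by rewrite cardsU kk' cards0 k3 k'3 => /leq_trans/(_ B5).
  have De : B = e by apply: (full M1) => //; exact: subsetUl.
  have Df : B = f by apply: (full M2) => //; exact: subsetUr.
  by have := disjointFr dM12 eM1; rewrite -De Df fM2'.
have := max_card (mem ([set t | connect (adjacent H) x t] :|: [set t | connect (adjacent H) y t])).
rewrite cardsU; set I := _ :&: _.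
have -> : I = set0.
  apply/setP=> t; rewrite !inE; apply: contraNF not_conn => /andP[xt].
  by rewrite [connect _ y t]H_sym; exact: connect_trans.
by rewrite cards0; have := big x; have := big y; lia.
Qed.

End HypergraphTheory.

(** * Cube roots of unity *)

Section NoCubeRoot.

Variable F : finFieldType.
Local Open Scope ring_scope.

(** A root x satisfies x^3 = 1, so x = x^q = x^2, which leaves x = 1; then
    3 = 0 while q = 0 in F, which contradicts q = 2 mod 3. *)
Lemma no_primitive_cube_root (x : F) : #|F| = 2 %[mod 3] -> x ^+ 2 + x + 1 != 0.
Proof.
move=> hq; apply/eqP => x_root.
have qE : #|F| = (3 * (#|F| %/ 3) + 2)%N.
  by rewrite mulnC {1}(divn_eq #|F| 3) hq.
have x3 : x ^+ 3 = 1.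
  have <- : (x - 1) * (x ^+ 2 + x + 1) + 1 = x ^+ 3 by ring.
  by rewrite x_root mulr0 add0r.
have xx : x ^+ 2 = x by rewrite -[RHS]expf_card qE exprD exprM x3 expr1n mul1r.
have x0 : x != 0.
  by apply: contraTneq isT => x0; move/eqP: x_root; rewrite x0 expr0n /= !add0r oner_eq0.
have x1 : x = 1 by apply: (mulfI x0); rewrite mulr1 -expr2.
have three0 : 3%:R = 0 :> F by rewrite -x_root x1; ring.
have := expg_cardG (in_setT (1 : F)); rewrite FinRing.zmodXgE cardsT => q0.
have two0 : 2%:R = 0 :> F.
  by move: q0; rewrite -[_ *+ _]/(_%:R) qE natrD natrM three0 mul0r add0r.
have : 1 != 0 :> F := oner_neq0 F.
by have -> : 1 = 3%:R - 2%:R :> F by [ring]; rewrite two0 three0 subr0 eqxx.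
Qed.

End NoCubeRoot.

(** * The factors of the maps mob a b *)

Section Mobius.

Variable F : finFieldType.
Hypothesis card_mod3 : #|F| = 2%N %[mod 3].
Implicit Types (a b c d x y z : F) (p q r : option F) (M : hypergraph (option F)).
Local Open Scope ring_scope.
Local Notation C := (mob_factorisation F).

(** This is a^2 (t^2 + t + 1) for t = b / a, and a root t would be a primitive
    cube root of unity. *)
Lemma norm_neq0 a b : a != 0 -> a ^+ 2 + a * b + b ^+ 2 != 0.
Proof.
move=> a0; have -> : a ^+ 2 + a * b + b ^+ 2 = a ^+ 2 * ((b / a) ^+ 2 + b / a + 1).
  by field.
by rewrite mulf_neq0 ?expf_neq0 ?no_primitive_cube_root.
Qed.

Lemma mob_neq a b p : a != 0 -> mob a b p != p.
Proof.
move=> a0; case: p => [y|] //=; have [-> //|yab] := eqVneq y (a + b).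
apply/eqP => -[eq_y].
have d0 : a + b - y != 0 by rewrite subr_eq0 eq_sym.
have : a ^+ 2 + a * (b - y) + (b - y) ^+ 2 == 0.
  have -> : a ^+ 2 + a * (b - y) + (b - y) ^+ 2
      = (a + b - y) * (b + a ^+ 2 / (a + b - y) - y) by field.
  by rewrite eq_y subrr mulr0.
by rewrite (negbTE (norm_neq0 _ a0)).
Qed.

Lemma mobK3 a b p : a != 0 -> mob a b (mob a b (mob a b p)) = p.
Proof.
move=> a0; have aba : (b == a + b) = false.
  by rewrite -subr_eq0 opprD addrCA subrr addr0 oppr_eq0 (negbTE a0).
have ab : b + a ^+ 2 / (a + b - b) = a + b by field; rewrite addrK.
case: p => [y|] /=; last by rewrite aba /= ab eqxx.
have [->|yab] := eqVneq y (a + b); first by rewrite /= aba /= ab.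
rewrite /=; have d0 : a + b - y != 0 by rewrite subr_eq0 eq_sym.
have [->|yb] := eqVneq y b; first by rewrite ab eqxx.
have e0 : b - y != 0 by rewrite subr_eq0 eq_sym.
have -> : b + a ^+ 2 / (a + b - y) = a + b - a * (b - y) / (a + b - y) by field.
have f0 : a * (b - y) / (a + b - y) != 0 by rewrite !mulf_neq0 ?invr_neq0.
case: eqVneq => [/eqP|_]; first by rewrite -subr_eq0 addrAC subrr add0r oppr_eq0 (negbTE f0).
have -> : a + b - (a + b - a * (b - y) / (a + b - y)) = a * (b - y) / (a + b - y) by ring.
have -> : b + a ^+ 2 / (a * (b - y) / (a + b - y)) = a + b + a ^+ 2 / (b - y).
  by field; rewrite e0 d0 a0.
have g0 : a ^+ 2 / (b - y) != 0 by rewrite !mulf_neq0 ?invr_neq0 ?expf_neq0.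
rewrite /= -subr_eq0 addrAC subrr add0r (negbTE g0); congr Some.
by field; rewrite e0 opprD addrA subrr add0r oppr_eq0 expf_neq0.
Qed.

Lemma finv_mob a b p : a != 0 -> finv (mob a b) p = mob a b (mob a b p).
Proof. by move=> a0; rewrite -{1}(mobK3 b p a0) finv_f //; exact: mob_inj. Qed.

Lemma mob2_neq a b p : a != 0 -> mob a b (mob a b p) != p.
Proof. by move=> a0; rewrite -{2}(mobK3 b p a0) eq_sym mob_neq. Qed.

Definition mob_edge a b p : {set option F} :=
  [set p; mob a b p; mob a b (mob a b p)].

Lemma mob_factorE a b : a != 0 -> mob_factor a b = [set mob_edge a b p | p : option F].
Proof. by move=> a0; apply: eq_imset => p; rewrite finv_mob. Qed.

Lemma mob_edge_mob a b p : a != 0 -> mob_edge a b (mob a b p) = mob_edge a b p.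
Proof. by move=> a0; rewrite /mob_edge mobK3 // setUC setUA. Qed.

Lemma mob_edge_eq a b p q : a != 0 -> q \in mob_edge a b p -> mob_edge a b q = mob_edge a b p.
Proof.
move=> a0; rewrite !inE => /orP[/orP[]|] /eqP-> //; first exact: mob_edge_mob.
by rewrite !mob_edge_mob.
Qed.

Lemma mem_mob_edge a b p : p \in mob_edge a b p.
Proof. by rewrite !inE eqxx. Qed.

Lemma card_mob_edge a b p : a != 0 -> #|mob_edge a b p| = 3%N.
Proof.
move=> a0; rewrite /mob_edge setUC cardsU1 cards2 !inE negb_or.
by rewrite mob2_neq // mob_neq // eq_sym mob_neq.
Qed.

Lemma mob_factor_edge a b M p : a != 0 -> M = mob_factor a b ->
  forall e, e \in M -> p \in e -> e = mob_edge a b p.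
Proof.
by move=> a0 -> e; rewrite mob_factorE // => /imsetP[q _ ->] /(mob_edge_eq a0).
Qed.


Lemma one_factor_mob a b : a != 0 -> one_factor (complete3 (option F)) (mob_factor a b).
Proof.
move=> a0; have edgeP := mob_factor_edge a0 (erefl (mob_factor a b)).
apply/andP; split.
  by rewrite mob_factorE //; apply/subsetP=> _ /imsetP[p _ ->]; rewrite inE card_mob_edge.
apply/and3P; split.
- apply/eqP/setP=> p; rewrite inE; apply/bigcupP; exists (mob_edge a b p).
    by rewrite mob_factorE ?imset_f.
  exact: mem_mob_edge.
- apply/trivIsetP=> e f eM fM; apply: contraR => /pred0Pn[p /andP[/= pe pf]].
  by rewrite (edgeP p e) // (edgeP p f).
- rewrite mob_factorE //; apply/imsetP=> -[p _ /setP/(_ p)].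
  by rewrite mem_mob_edge inE.
Qed.

(** [mob (- a) (a + b)] is the inverse of [mob a b]. *)
Lemma mob_factor_opp a b : a != 0 -> mob_factor (- a) (a + b) = mob_factor a b.
Proof.
move=> a0; have a0' : - a != 0 by rewrite oppr_eq0.
have mobK p : mob a b (mob (- a) (a + b) p) = p.
  case: p => [y|] /=; last by rewrite eqxx.
  have -> : - a + (a + b) = b by ring.
  have [-> //|yb] := eqVneq y b; rewrite /=.
  have e0 : b - y != 0 by rewrite subr_eq0 eq_sym.
  have g0 : (- a) ^+ 2 / (b - y) != 0 by rewrite !mulf_neq0 ?invr_neq0 ?expf_neq0.
  rewrite -subr_eq0 addrAC subrr add0r (negbTE g0); congr Some.
  by field; rewrite e0 opprD addrA subrr add0r oppr_eq0 expf_neq0.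
have mob_opp p : mob (- a) (a + b) p = mob a b (mob a b p).
  by rewrite -{2}[p]mobK mobK3.
rewrite !mob_factorE //; apply: eq_imset => p.
by rewrite /mob_edge !mob_opp mobK3 // setUAC.
Qed.

Lemma mob_factorisationP M :
  reflect (exists a b, a != 0 /\ M = mob_factor a b) (M \in C).
Proof.
apply: (iffP imset2P) => [[a b]|[a [b [a0 ->]]]].
  by rewrite !inE => a0 _ ->; exists a, b.
by exists a b; rewrite // !inE.
Qed.

Lemma mem_mob_factorisation a b : a != 0 -> mob_factor a b \in C.
Proof. by move=> a0; apply/mob_factorisationP; exists a, b. Qed.

Lemma hmap_mob (g : {perm option F}) a b a' b' : a != 0 -> a' != 0 ->
    (forall p, g (mob a b p) = mob a' b' (g p)) ->
  hmap g (mob_factor a b) = mob_factor a' b'.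
Proof.
move=> a0 a0' gm; rewrite !mob_factorE // /hmap.
have g_edge p : g @: mob_edge a b p = mob_edge a' b' (g p).
  by rewrite /mob_edge !imsetU !imset_set1 !gm.
apply/setP=> e; apply/imsetP/imsetP => [[_ /imsetP[p _ ->] ->]|[p _ ->]].
  by exists (g p).
exists (mob_edge a b ((g^-1)%g p)); first by rewrite imset_f.
by rewrite g_edge permKV.
Qed.

(** * Projective equivalence and the 1-factorisation *)

Definition preserves (g : {perm option F}) :=
  forall M, M \in C -> hmap g M \in C.

Lemma preservesM g h : preserves g -> preserves h -> preserves (g * h)%g.
Proof. by move=> pg ph M MC; rewrite hmapM; apply/ph/pg. Qed.

Lemma preserves1 : preserves 1%g.
Proof. by move=> M; rewrite hmap1. Qed.

Definition affine c d p : option F := omap (fun y => c * y + d) p.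

Lemma affine_inj c d : c != 0 -> injective (affine c d).
Proof. by move=> c0 [x|] [y|] //= [] /addIr/(mulfI c0)->. Qed.

Definition affine_perm c d (c0 : c != 0) := perm (@affine_inj c d c0).

Lemma hmap_affine c d (c0 : c != 0) a b : a != 0 ->
  hmap (affine_perm d c0) (mob_factor a b) = mob_factor (c * a) (c * b + d).
Proof.
move=> a0; apply: hmap_mob => // [|[y|]]; rewrite ?mulf_neq0 // !permE //=.
have -> : c * a + (c * b + d) = c * (a + b) + d by ring.
rewrite (inj_eq (addIr d)) (inj_eq (mulfI c0)).
have [//|yab] := eqVneq y (a + b); congr Some.
have d0 : a + b - y != 0 by rewrite subr_eq0 eq_sym.
have -> : c * (a + b) + d - (c * y + d) = c * (a + b - y) by ring.
by field; rewrite d0 c0.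
Qed.

Lemma preserves_affine c d (c0 : c != 0) : preserves (affine_perm d c0).
Proof.
move=> _ /mob_factorisationP[a [b [a0 ->]]]; rewrite hmap_affine //.
by rewrite mem_mob_factorisation // mulf_neq0.
Qed.

Definition inversion p : option F :=
  if p is Some y then if y == 0 then None else Some y^-1 else Some 0.

Lemma inversionK : involutive inversion.
Proof.
case=> [y|] /=; last by rewrite eqxx.
by have [->//|y0] := eqVneq y 0; rewrite /= invr_eq0 (negbTE y0) invrK.
Qed.

Definition inversion_perm := perm (inv_inj inversionK).

(** In terms of matrices, conjugating [mob a b], with rows (- b, n) and
    (-1, a + b), by the inversion exchanges its two rows and its two columns;
    dividing by - n gives the parameters on the right-hand side. *)
Lemma preserves_inversion : preserves inversion_perm.
Proof.
move=> _ /mob_factorisationP[a [b [a0 ->]]]; pose n := a ^+ 2 + a * b + b ^+ 2.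
have n0 : n != 0 by exact: norm_neq0.
have a0' : - a / n != 0 by rewrite mulf_neq0 ?invr_neq0 ?oppr_eq0.
suff -> : hmap inversion_perm (mob_factor a b) = mob_factor (- a / n) ((a + b) / n).
  exact: mem_mob_factorisation.
have sum_ab : - a / n + (a + b) / n = b / n by field.
apply: hmap_mob => // -[y|]; rewrite !permE /=; last first.
  rewrite sum_ab [0 == _]eq_sym mulf_eq0 invr_eq0 (negbTE n0) orbF.
  have [//|b0] := eqVneq b 0; congr Some; rewrite /n.
  by field; rewrite n0 b0.
(* the image of 1 / y under the map on the right-hand side *)
have rhsE : y != 0 -> mob (- a / n) ((a + b) / n) (Some y^-1) =
    if n - b * y == 0 then None else Some ((a + b - y) / (n - b * y)).
  move=> y0; rewrite /= sum_ab.
  have -> : (y^-1 == b / n) = (n - b * y == 0).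
    rewrite -subr_eq0 (_ : y^-1 - b / n = (n - b * y) / (n * y)).
      by rewrite mulf_eq0 invr_eq0 mulf_eq0 (negbTE n0) (negbTE y0) !orbF.
    by field; rewrite n0 y0.
  case: eqVneq => // e0; congr Some.
  have -> : b / n - y^-1 = - (n - b * y) / (n * y) by field; rewrite n0 y0.
  have -> : a + b - y = ((n - b * y) * (a + b) - a ^+ 2 * y) / n.
    by apply: (mulIf n0); rewrite mulfVK //; rewrite /n; ring.
  by field; rewrite oppr_eq0 y0 e0 n0.
have [y_0|y0] := eqVneq y 0.
  rewrite y_0 [0 == _]eq_sym /= subr0.
  have [ab0|ab0] := eqVneq (a + b) 0; first by rewrite ab0 mul0r.
  have -> : b + a ^+ 2 / (a + b) = n / (a + b) by rewrite /n; field.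
  by rewrite /= mulf_eq0 invr_eq0 (negbTE n0) (negbTE ab0) invf_div.
rewrite -[RHS]/(mob _ _ (Some y^-1)) rhsE //.
have [->|yab] := eqVneq y (a + b).
  have -> : n - b * (a + b) = a ^+ 2 by rewrite /n; ring.
  by rewrite expf_eq0 (negbTE a0) andbF subrr mul0r.
have d0 : a + b - y != 0 by rewrite subr_eq0 eq_sym.
have -> : b + a ^+ 2 / (a + b - y) = (n - b * y) / (a + b - y) by rewrite /n; field.
by rewrite /= mulf_eq0 invr_eq0 (negbTE d0) orbF invf_div.
Qed.

Lemma preserves_to_infinity p : exists2 g, preserves g & g p = None.
Proof.
case: p => [y|]; last by exists 1%g; [exact: preserves1 | rewrite perm1].
have one0 : 1 != 0 :> F := oner_neq0 F.
exists (affine_perm (- y) one0 * inversion_perm)%g.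
  exact: preservesM (preserves_affine _ _) preserves_inversion.
by rewrite permM !permE /= mul1r subrr eqxx.
Qed.

(** A point is moved to oo first; the affine maps, which fix oo, are
    2-transitive on the other points. *)
Lemma preserves_3transitive p q r : p != q -> p != r -> q != r ->
  exists2 g, preserves g & [/\ g p = None, g q = Some 0 & g r = Some 1].
Proof.
move=> pq pr qr; have [g pg gp] := preserves_to_infinity p.
case Dq: (g q) => [y|]; last by rewrite -gp in Dq; rewrite (perm_inj Dq) eqxx in pq.
case Dr: (g r) => [z|]; last by rewrite -gp in Dr; rewrite (perm_inj Dr) eqxx in pr.
have zy : z - y != 0.
  rewrite subr_eq0; apply: contraNneq qr => zy; apply/eqP/(@perm_inj _ g).
  by rewrite Dq Dr zy.
have c0 : (z - y)^-1 != 0 by rewrite invr_eq0.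
exists (g * affine_perm (- (z - y)^-1 * y)%R c0)%g.
  exact: preservesM pg (preserves_affine _ _).
rewrite !permM gp Dq Dr !permE /=; split=> //; congr Some; first by rewrite mulNr subrr.
by rewrite mulNr -mulrBr mulVf.
Qed.

(** The orbit of oo under [mob y 0]. *)
Definition standard_edge y : {set option F} := [set None; Some 0; Some y].

Lemma mem_standard_edge y : y != 0 -> standard_edge y \in mob_factor y 0.
Proof.
move=> y0; rewrite mob_factorE //; apply/imsetP; exists None => //.
rewrite /mob_edge /= addr0 eq_sym (negbTE y0) subr0 add0r.
by rewrite expr2 mulfK.
Qed.

(** The orbit of oo under [mob a b] is {oo, b, a + b}, so either b = 0 and
    a = y, or a + b = 0 and b = y; the second map is the inverse of the first. *)
Lemma standard_edge_factor y M :
  y != 0 -> M \in C -> standard_edge y \in M -> M = mob_factor y 0.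
Proof.
move=> y0 /mob_factorisationP[a [b [a0 DM]]] eM.
have := mob_factor_edge a0 DM eM (_ : None \in _); rewrite !inE => /(_ isT).
rewrite /mob_edge /= (_ : (b == a + b) = false); last first.
  by rewrite -subr_eq0 opprD addrCA subrr addr0 oppr_eq0 (negbTE a0).
rewrite (_ : b + _ = a + b); last by field; rewrite addrK.
move=> De; have : Some 0 \in standard_edge y by rewrite !inE eqxx orbT.
have : Some y \in standard_edge y by rewrite !inE eqxx orbT.
rewrite De {De eM} !inE => /orP[/orP[/eqP //|]|] /eqP[yE] /orP[/orP[/eqP //|]|] /eqP[zE].
- by rewrite yE -zE eqxx in y0.
- by rewrite DM -mob_factor_opp // yE -zE -[a](addrK b) -zE sub0r opprK.
- by rewrite DM yE -zE addr0.
- by rewrite yE -zE eqxx in y0.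
Qed.

Lemma standard_edge_image p q r : p != q -> p != r -> q != r ->
  exists2 g, preserves g & g @: [set p; q; r] = standard_edge 1.
Proof.
move=> pq pr qr; have [g pg [gp gq gr]] := preserves_3transitive pq pr qr.
by exists g; rewrite // !imsetU !imset_set1 gp gq gr.
Qed.

Lemma mob_factor_edges M e : M \in C -> e \in M ->
  exists p q r, [/\ p != q, p != r, q != r & e = [set p; q; r]].
Proof.
case/mob_factorisationP=> a [b [a0 ->]]; rewrite mob_factorE // => /imsetP[p _ ->].
exists p, (mob a b p), (mob a b (mob a b p)).
by rewrite ![p == _]eq_sym [mob _ _ _ == mob _ _ _]eq_sym mob2_neq ?mob_neq.
Qed.

Lemma factor_eq_of_edge M1 M2 e :
  M1 \in C -> M2 \in C -> e \in M1 -> e \in M2 -> M1 = M2.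
Proof.
move=> M1C M2C eM1 eM2; have one0 : 1 != 0 :> F := oner_neq0 F.
have [p [q [r [pq pr qr De]]]] := mob_factor_edges M1C eM1.
have [g pg ge] := standard_edge_image pq pr qr; rewrite -De in ge.
apply: (@hmap_inj _ g); rewrite (@standard_edge_factor 1 (hmap g M1)) ?pg //.
  by rewrite (@standard_edge_factor 1 (hmap g M2)) ?pg // -ge mem_hmap.
by rewrite -ge mem_hmap.
Qed.

(** Relabelling is injective and the set of factors is finite. *)
Lemma preserves_surj g M : preserves g -> M \in C -> exists2 N, N \in C & hmap g N = M.
Proof.
move=> pg MC; have /eqP DC : [set hmap g N | N in C] == C.
  rewrite eqEcard card_imset ?leqnn ?andbT; last exact: hmap_inj.
  by apply/subsetP=> _ /imsetP[N NC ->]; exact: pg.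
by rewrite -DC in MC; case/imsetP: MC => N NC ->; exists N.
Qed.

Lemma edge_factor p q r : p != q -> p != r -> q != r ->
  exists2 M, M \in C & [set p; q; r] \in M.
Proof.
move=> pq pr qr; have [g pg ge] := standard_edge_image pq pr qr.
have one0 : 1 != 0 :> F := oner_neq0 F.
have [N NC gN] := preserves_surj pg (mem_mob_factorisation 0 one0).
by exists N => //; rewrite -(mem_hmap g) ge gN mem_standard_edge.
Qed.

Lemma mob_one_factorisation : one_factorisation (complete3 (option F)) C.
Proof.
have fC M : M \in C -> one_factor (complete3 (option F)) M.
  by case/mob_factorisationP=> a [b [a0 ->]]; exact: one_factor_mob.
apply/andP; split; last by apply/forall_inP.
apply/and3P; split.
- apply/eqP/setP=> e; apply/bigcupP/idP=> [[M /fC /andP[M3 _]]|].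
    exact: (subsetP M3).
  rewrite inE => e3.
  have [p pe] : exists p, p \in e by apply/card_gt0P; rewrite (eqP e3).
  move: e3; rewrite (cardsD1 p) pe eqSS => /cards2P[q [r [qr De]]].
  have Dpqr : e = [set p; q; r] by rewrite -(setD1K pe) De setUA.
  have pq : p != q by apply: contraTneq (set21 q r) => eq_p; rewrite -De -eq_p !inE eqxx.
  have pr : p != r by apply: contraTneq (set22 q r) => eq_p; rewrite -De -eq_p !inE eqxx.
  by have [M MC eM] := edge_factor pq pr qr; exists M; rewrite // Dpqr.
- apply/trivIsetP=> M1 M2 M1C M2C; apply: contraR => /pred0Pn[e /andP[/= eM1 eM2]].
  by rewrite (factor_eq_of_edge M1C M2C eM1 eM2).
- apply/negP=> /fC/andP[_ /and3P[/eqP/setP/(_ None)]].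
  by rewrite /cover big_set0 !inE.
Qed.

End Mobius.

(** * Coincidences of two maps *)

Section Coincidences.

Variable F : finFieldType.
Hypothesis card_mod3 : #|F| = 2 %[mod 3].
Implicit Types (a b c d x y z r : F) (p q : option F) (M : hypergraph (option F)).
Local Open Scope ring_scope.
Local Notation C := (mob_factorisation F).

Lemma adjacent_mob a b p q : a != 0 ->
  adjacent (mob_factor a b) p q = (q \in mob_edge a b p).
Proof.
move=> a0; apply/existsP/idP => [[e /and3P[eM pe qe]]|qe].
  by rewrite -(mob_factor_edge a0 (erefl _) eM pe).
by exists (mob_edge a b p); rewrite mem_mob_edge qe mob_factorE ?imset_f.
Qed.

(** Every x in the first set gives two edges sharing x and m x; the second set
    plays the same role for the inverse of m', which has the same factor. *)
Definition coincidences a b a' b' : nat :=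
  (#|[set p | mob a b p == mob a' b' p]| + #|[set p | mob a' b' (mob a b p) == p]|)%N.

(** A vertex p has the neighbours m p, m^2 p, m' p, m'^2 p, and the
    repetitions among them, summed over p, count each coincidence twice. *)
Lemma card_shadow_coincidences a b a' b' : a != 0 -> a' != 0 ->
  (#|shadow (mob_factor a b :|: mob_factor a' b')| + 2 * coincidences a b a' b'
     = 4 * #|{: option F}|)%N.
Proof.
move=> a0 a0'; set m := mob a b; set m' := mob a' b'.
have nbr p : [set q | (p != q) && adjacent (mob_factor a b :|: mob_factor a' b') p q]
           = [set m p; m (m p)] :|: [set m' p; m' (m' p)].
  apply/setP=> q; rewrite !inE adjacentU !adjacent_mob // !inE -/m -/m' [p == q]eq_sym.
  have [->|_] /= := eqVneq q p; last by rewrite orbA.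
  by rewrite ![p == _]eq_sym /m /m' !(negbTE (mob_neq _ _ _ _)) // !(negbTE (mob2_neq _ _ _ _)).
rewrite card_shadow (eq_bigr _ (fun p _ => congr1 (fun A => #|pred_of_set A|) (nbr p))).
have inj_m : injective m := @mob_inj F a b a0.
have inj_m' : injective m' := @mob_inj F a' b' a0'.
have cnt (P : pred (option F)) : #|[set p | P p]| = (\sum_p P p)%N.
  by rewrite -sum1_card big_mkcond; apply: eq_bigr => p _; rewrite inE; case: (P p).
have -> : (2 * coincidences a b a' b' = \sum_p ((m p == m' p) + (m p == m' (m' p))
    + (m (m p) == m' p) + (m (m p) == m' (m' p))))%N.
  have c12 p : (m p == m' (m' p)) = (m' (m p) == p).
    by rewrite -(inj_eq inj_m') /m' mobK3.
  have c21 : (\sum_p (m (m p) == m' p) = \sum_p (m' (m p) == p))%N.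
    rewrite (reindex_inj inj_m); apply: eq_bigr => p _.
    by rewrite {1 2 3}/m mobK3 // eq_sym.
  have c22 : (\sum_p (m (m p) == m' (m' p)) = \sum_p (m p == m' p))%N.
    rewrite (reindex_inj inj_m); apply: eq_bigr => p _.
    by rewrite {1 2 3}/m mobK3 // -(inj_eq inj_m') /m' mobK3 // eq_sym.
  rewrite !big_split /= /coincidences !cnt -/m -/m' c21 c22.
  rewrite (eq_bigr _ (fun p _ => congr1 nat_of_bool (c12 p))).
  by rewrite mul2n -addnn -[RHS]addnA [X in (_ + X = _)%N]addnC.
rewrite -big_split /= -[RHS]mulnC -sum_nat_const; apply: eq_bigr => p _.
by apply: card_setU2; rewrite eq_sym mob_neq.
Qed.

Lemma coincidences_uniform a1 b1 c1 d1 a2 b2 c2 d2 :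
    a1 != 0 -> c1 != 0 -> a2 != 0 -> c2 != 0 ->
    mob_factor a1 b1 != mob_factor c1 d1 -> mob_factor a2 b2 != mob_factor c2 d2 ->
    uniform_one_factorisation (complete3 (option F)) C ->
  coincidences a1 b1 c1 d1 = coincidences a2 b2 c2 d2.
Proof.
move=> a10 c10 a20 c20 neq1 neq2 [_ [U isoU]].
have shadowU M1 M2 : M1 \in C -> M2 \in C -> M1 != M2 ->
    #|shadow (M1 :|: M2)| = #|shadow U|.
  move=> M1C M2C neq; have [f <-] := isoU _ _ M1C M2C neq.
  by rewrite -(card_shadow_hmap f).
have := card_shadow_coincidences b1 d1 a10 c10.
rewrite -(card_shadow_coincidences b2 d2 a20 c20).
by rewrite !shadowU ?mem_mob_factorisation // => /addnI/eqP; rewrite eqn_pmul2l // => /eqP.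
Qed.

Definition quad_roots a b c : {set F} := [set x | a * x ^+ 2 + b * x + c == 0].

Lemma card_roots_square a b c r : 2%:R != 0 :> F -> a != 0 ->
  b ^+ 2 - 4%:R * a * c = r ^+ 2 -> #|quad_roots a b c| = (r != 0).+1.
Proof.
move=> two0 a0 Dr.
have a2 : 2%:R * a != 0 by rewrite mulf_neq0.
have -> : quad_roots a b c = [set (r - b) / (2%:R * a); (- r - b) / (2%:R * a)].
  apply/setP=> x; rewrite !inE -[RHS]orbC.
  have eq_div u : (x == u / (2%:R * a)) = (2%:R * a * x == u).
    by apply/eqP/eqP=> [->|<-]; rewrite mulrC ?mulfVK ?mulKf.
  rewrite !eq_div -![_ == _ - b]subr_eq0 -mulf_eq0.
  have -> : (2%:R * a * x - (- r - b)) * (2%:R * a * x - (r - b))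
      = 2%:R * (2%:R * a) * (a * x ^+ 2 + b * x + c).
    by rewrite -[RHS]addr0 -(subrr (r ^+ 2)) -{1}Dr; ring.
  by rewrite mulf_eq0 (negbTE (mulf_neq0 two0 a2)).
rewrite cards2; congr (nat_of_bool _).+1; rewrite -subr_eq0.
have -> : (r - b) / (2%:R * a) - (- r - b) / (2%:R * a) = r / a by field; rewrite two0 a0.
by rewrite mulf_eq0 invr_eq0 (negbTE a0) orbF.
Qed.

Lemma card_roots_nonsquare a b c :
  (forall r, r ^+ 2 != b ^+ 2 - 4%:R * a * c) -> #|quad_roots a b c| = 0%N.
Proof.
move=> nsq; apply: eq_card0 => x; rewrite inE; apply/eqP => x0.
have /eqP := nsq (2%:R * a * x + b); apply.
by rewrite -[LHS]subr0 -(mulr0 (4%:R * a)) -x0; ring.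
Qed.

Lemma card_roots_parity a b c : 2%:R != 0 :> F -> a != 0 ->
  odd #|quad_roots a b c| = (b ^+ 2 - 4%:R * a * c == 0).
Proof.
move=> two0 a0; have [/existsP[r /eqP Dr]|/existsPn nsq] :=
    boolP [exists r, r ^+ 2 == b ^+ 2 - 4%:R * a * c].
  by rewrite (card_roots_square two0 a0 (esym Dr)) -Dr expf_eq0 /=; case: eqP.
rewrite card_roots_nonsquare //; apply/esym/negbTE; rewrite eq_sym.
by have := nsq 0; rewrite expr0n.
Qed.

(** Writing points as 1 - y clears the pole of [mob 1 b] to y = - b. *)
Lemma mob1E b y : mob 1 b (Some (1 - y)) =
  if y + b == 0 then None else Some (b + (y + b)^-1).
Proof.
rewrite /= -[in LHS]subr_eq0 (_ : 1 - y - (1 + b) = - (y + b)); last by ring.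
by rewrite oppr_eq0 expr1n div1r (_ : 1 + b - (1 - y) = y + b) //; ring.
Qed.

Lemma card_reparam (P : pred (option F)) (Q : pred F) : ~~ P None ->
  (forall y, P (Some (1 - y)) = Q (1 - y)) -> #|[set p | P p]| = #|[set x | Q x]|.
Proof.
move=> P0 PQ; rewrite -(card_imset (mem [set x | Q x]) Some_inj).
congr #|pred_of_set _|; apply/setP=> -[x|]; rewrite inE.
  by rewrite mem_imset ?inE; [rewrite -[x](subKr 1) PQ | exact: Some_inj].
by rewrite (negbTE P0); apply/esym/negbTE/imsetP => -[].
Qed.

Lemma mob_translate_eq b : b != 0 ->
  #|[set p | mob 1 0 p == mob 1 b p]| = #|quad_roots 1 (- (b + 2%:R)) b|.
Proof.
move=> b0; apply: card_reparam => [|y].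
  by rewrite /= (inj_eq Some_inj) eq_sym.
rewrite !mob1E addr0 add0r.
have -> : 1 * (1 - y) ^+ 2 + - (b + 2%:R) * (1 - y) + b = y * (y + b) - 1 by ring.
have [->|y0] := eqVneq y 0; first by rewrite mul0r !add0r (negbTE b0) oppr_eq0 oner_eq0.
have [->|yb] := eqVneq (y + b) 0; first by rewrite mulr0 add0r oppr_eq0 oner_eq0.
rewrite (inj_eq Some_inj) -subr_eq0.
have -> : y^-1 - (b + (y + b)^-1) = - b / (y * (y + b)) * (y * (y + b) - 1).
  by field; rewrite y0 yb.
by rewrite mulrI_eq0 //; apply: mulfI; rewrite !mulf_neq0 ?invr_eq0 ?oppr_eq0 ?mulf_neq0.
Qed.

Lemma mob_translate_inv b : b + 1 != 0 ->
  #|[set p | mob 1 b (mob 1 0 p) == p]|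
    = #|quad_roots (b + 1) (- (b + 1) ^+ 2) (b ^+ 2 + 1)|.
Proof.
move=> b1; apply: card_reparam => [|y].
  by rewrite [mob 1 0 None]/= -(subrr 1) mob1E [1 + b]addrC (negbTE b1).
rewrite mob1E addr0 add0r.
set P := (b + 1) * _ + _ + _.
have PE : P = y - (1 - y - b) * (y + b * y - 1) by rewrite /P; ring.
have [y_0|y0] := eqVneq y 0.
  by rewrite PE y_0 /= (inj_eq Some_inj) -subr_eq0 -oppr_eq0; congr (_ == 0); ring.
rewrite -[y^-1](subKr 1) mob1E.
have -> : 1 - y^-1 + b = (y + b * y - 1) / y by field.
rewrite mulf_eq0 invr_eq0 (negbTE y0) orbF PE.
have [->|d0] := eqVneq (y + b * y - 1) 0; first by rewrite mulr0 subr0 (negbTE y0).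
rewrite (inj_eq Some_inj) -subr_eq0.
have -> : b + ((y + b * y - 1) / y)^-1 - (1 - y)
    = (y - (1 - y - b) * (y + b * y - 1)) / (y + b * y - 1) by field; rewrite y0 d0.
by rewrite mulf_eq0 invr_eq0 (negbTE d0) orbF.
Qed.

(** The orbits of oo are {oo, 0, 1} and {oo, b, b + 1}. *)
Lemma translate_neq b : b != 0 -> b + 1 != 0 -> mob_factor 1 0 != mob_factor 1 b.
Proof.
move=> b0 b1; have one0 : 1 != 0 :> F := oner_neq0 F; apply/negP=> /eqP eq_factor.
have := mem_standard_edge one0; rewrite eq_factor => eM.
have := mob_factor_edge one0 (erefl _) eM (_ : None \in _); rewrite !inE => /(_ isT) De.
have : Some 0 \in standard_edge (1 : F) by rewrite !inE eqxx orbT.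
rewrite De !inE /= => /orP[|].
  by rewrite (inj_eq Some_inj) eq_sym (negbTE b0).
have -> : (b == 1 + b) = false.
  by rewrite -subr_eq0 opprD addrCA subrr addr0 oppr_eq0 oner_eq0.
by rewrite (inj_eq Some_inj) expr1n addrK invr1 mulr1 eq_sym (negbTE b1).
Qed.

End Coincidences.

(** * Odd characteristic *)

Section OddCharacteristic.

Variable F : finFieldType.
Hypotheses (card_mod3 : #|F| = 2 %[mod 3]) (two_neq0 : (2%:R != 0 :> F)%R).
Implicit Types (b c e r x y z : F).
Local Open Scope ring_scope.

Lemma four_neq0 : 4%:R != 0 :> F.
Proof. by rewrite (natrM _ 2 2) mulf_neq0. Qed.

Lemma sqr_add3_neq0 x : x ^+ 2 + 3%:R != 0.
Proof.
have := no_primitive_cube_root ((x - 1) / 2%:R) card_mod3; apply: contraNneq => x0.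
have -> : ((x - 1) / 2%:R) ^+ 2 + (x - 1) / 2%:R + 1 = (x ^+ 2 + 3%:R) / 4%:R.
  by field; rewrite two_neq0 four_neq0.
by rewrite x0 mul0r.
Qed.

Lemma translate_coincidencesE b : b != 0 -> b + 1 != 0 ->
  coincidences 1 0 1 b = addn #|quad_roots 1 (- (b + 2%:R)) b|
      #|quad_roots (b + 1) (- (b + 1) ^+ 2) (b ^+ 2 + 1)|.
Proof. by move=> b0 b1; rewrite /coincidences mob_translate_eq ?mob_translate_inv. Qed.

Lemma discriminant_eq b : (- (b + 2%:R)) ^+ 2 - 4%:R * 1 * b = b ^+ 2 + 4%:R.
Proof. by ring. Qed.

Lemma discriminant_inv b :
  (- (b + 1) ^+ 2) ^+ 2 - 4%:R * (b + 1) * (b ^+ 2 + 1)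
    = (b ^+ 2 - 1) * (b ^+ 2 + 3%:R).
Proof. by ring. Qed.

(** A quadratic has an odd number of roots exactly when it has a double root. *)
Lemma coincidences_parity b : b != 0 -> b + 1 != 0 ->
  odd (coincidences 1 0 1 b) = (b ^+ 2 + 4%:R == 0) (+) (b == 1).
Proof.
move=> b0 b1; rewrite translate_coincidencesE // oddD !card_roots_parity ?oner_neq0 //.
rewrite discriminant_eq discriminant_inv mulf_eq0 (negbTE (sqr_add3_neq0 b)) orbF.
have -> : b ^+ 2 - 1 = (b + 1) * (b - 1) by ring.
by rewrite mulf_eq0 (negbTE b1) subr_eq0.
Qed.

Lemma one_add1 : 1 + 1 != 0 :> F.
Proof. by rewrite -[1 + 1]/(2%:R). Qed.

(** Only b = 0, 1, -1 and the at most two roots of b^2 + 4 are to be avoided. *)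
Lemma exists_even_coincidences : (5 < #|F|)%N ->
  exists2 b : F, b != 0 /\ b + 1 != 0 & ~~ odd (coincidences 1 0 1 b).
Proof.
move=> q5; have [i Di] : exists i, forall x, x ^+ 2 + 4%:R = 0 -> x = i \/ x = - i.
  have [/existsP[i /eqP i0]|/existsPn no_i] := boolP [exists i : F, i ^+ 2 + 4%:R == 0].
    exists i => x x0; have /eqP : x ^+ 2 = i ^+ 2 by apply: (addIr 4%:R); rewrite x0 i0.
    by rewrite eqf_sqr => /orP[] /eqP; [left | right].
  by exists 0 => x /eqP; rewrite (negbTE (no_i x)).
have [|b _] := @exists_notin F setT [:: 0; 1; -1; i; - i]; first by rewrite cardsT.
rewrite !inE !negb_or => /and5P[b0 b1 bN1 bi bNi].
have b1' : b + 1 != 0 by rewrite addr_eq0.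
exists b; rewrite // coincidences_parity // (negbTE b1) addbF.
by apply: contraNneq bi => /Di[-> //|bE]; rewrite bE eqxx in bNi.
Qed.

(** The solutions of e^2 = b^2 + 3 are parametrised by s = e - b.  Among
    the excluded values of s, which form the prime field, the nonzero ones are
    those for which b = 1 or b = -1. *)
Lemma char5_coincidences : 5%:R = 0 :> F -> (5 < #|F|)%N ->
  exists2 b : F, b != 0 /\ b + 1 != 0 & coincidences 1 0 1 b != coincidences 1 0 1 (1 : F).
Proof.
move=> five0 q5.
have eq5 x y z : x = y + 5%:R * z -> x = y by rewrite five0 mul0r addr0.
have -> : coincidences 1 0 1 (1 : F) = 2%N :> nat.
  rewrite translate_coincidencesE ?oner_neq0 ?one_add1 //.
  rewrite !(@card_roots_square _ _ _ _ 0) ?oner_neq0 ?one_add1 ?eqxx //.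
    by rewrite discriminant_inv expr1n subrr mul0r expr0n.
  by rewrite discriminant_eq; apply: (eq5 _ _ 1); ring.
have [|s _] := @exists_notin F setT [:: 0; 1; - 3%:R; 3%:R; -1]; first by rewrite cardsT.
rewrite !inE !negb_or => /and5P[s0 s1 sN3 s3 sN1].
pose b : F := (3%:R / s - s) / 2%:R; pose e : F := (3%:R / s + s) / 2%:R.
have eE : e ^+ 2 = b ^+ 2 + 3%:R by rewrite /e /b; field; rewrite two_neq0 s0.
have e0 : e != 0 by have := sqr_add3_neq0 b; rewrite -eE expf_eq0.
have bE : 2%:R * s * b = 3%:R - s ^+ 2 by rewrite /b; field; rewrite two_neq0 s0.
have b0 : b != 0.
  apply: contraNneq (sqr_add3_neq0 (3%:R * s)) => b0.
  have -> : (3%:R * s) ^+ 2 + 3%:R = 5%:R * 6%:R - 9%:R * (3%:R - s ^+ 2) by ring.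
  by rewrite -bE b0 five0 !(mul0r, mulr0) subr0.
have b1 : b - 1 != 0.
  have : (s - - 3%:R) * (s - 1) != 0 by rewrite mulf_neq0 ?subr_eq0.
  apply: contraNneq => b1.
  have -> : (s - - 3%:R) * (s - 1) = 2%:R * s * b - 2%:R * s * (b - 1) - (3%:R - s ^+ 2) by ring.
  by rewrite b1 bE mulr0 subr0 subrr.
have bN1 : b + 1 != 0.
  have : (s - 3%:R) * (s - -1) != 0 by rewrite mulf_neq0 ?subr_eq0.
  apply: contraNneq => b1'.
  have -> : (s - 3%:R) * (s - -1) = 2%:R * s * b - 2%:R * s * (b + 1) - (3%:R - s ^+ 2) by ring.
  by rewrite b1' bE mulr0 subr0 subrr.
exists b => //; rewrite translate_coincidencesE //.
have D1 : (- (b + 2%:R)) ^+ 2 - 4%:R * 1 * b = (b + 1) * (b - 1).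
  by rewrite discriminant_eq; apply: (eq5 _ _ 1); ring.
have D2 : (- (b + 1) ^+ 2) ^+ 2 - 4%:R * (b + 1) * (b ^+ 2 + 1) = (b + 1) * (b - 1) * e ^+ 2.
  by rewrite discriminant_inv eE; ring.
have [/existsP[r /eqP Dr]|/existsPn nsq] := boolP [exists r, r ^+ 2 == (b + 1) * (b - 1)].
  have r0 : r != 0 by have := mulf_neq0 bN1 b1; rewrite -Dr expf_eq0.
  rewrite (@card_roots_square _ _ _ _ r) ?oner_neq0 //; last by rewrite D1 Dr.
  rewrite (@card_roots_square _ _ _ _ (r * e)) //; first by rewrite r0 mulf_neq0.
  by rewrite D2 -Dr [RHS]exprMn.
rewrite card_roots_nonsquare => [|r]; last by rewrite D1.
rewrite card_roots_nonsquare // => r; rewrite D2; apply: contra (nsq (r / e)) => /eqP rE.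
by rewrite expr_div_n rE mulfK ?expf_neq0.
Qed.

Lemma uniform_odd_bound :
  uniform_one_factorisation (complete3 (option F)) (mob_factorisation F) ->
  (#|F| <= 5)%N.
Proof.
move=> unif; rewrite leqNgt; apply/negP=> q5.
have one0 : 1 != 0 :> F := oner_neq0 F.
have const (b : F) : b != 0 -> b + 1 != 0 -> coincidences 1 0 1 b = coincidences 1 0 1 (1 : F).
  move=> b0 b1.
  exact: (coincidences_uniform card_mod3 one0 one0 one0 one0
    (translate_neq b0 b1) (translate_neq one0 one_add1) unif).
have [five0|five_neq0] := eqVneq (5%:R : F) 0.
  have [b [b0 b1]] := char5_coincidences five0 q5.
  by rewrite const ?eqxx.
have [b [b0 b1]] := exists_even_coincidences q5.
rewrite (const b b0 b1).
rewrite (coincidences_parity one0 one_add1).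
rewrite eqxx addbT negbK.
have -> : 1 ^+ 2 + 4%:R = 5%:R :> F by ring.
by rewrite (negbTE five_neq0).
Qed.

End OddCharacteristic.

(** * Characteristic two *)

Section EvenCharacteristic.

Variable F : finFieldType.
Hypotheses (card_mod3 : #|F| = 2 %[mod 3]) (two0 : (2%:R = 0 :> F)%R).
Implicit Types (a b c d x y z r s t u v : F).
Local Open Scope ring_scope.

(** Reduces an identity of characteristic 2 to an identity over the integers,
    the multiple of 2 being given explicitly. *)
Lemma eq_mod2 z x y : x = y + 2%:R * z -> x = y.
Proof. by rewrite two0 mul0r addr0. Qed.

Lemma addrr_mod2 x : x + x = 0.
Proof. by apply: (@eq_mod2 x); ring. Qed.

Lemma addr_eq0_mod2 x y : (x + y == 0) = (x == y).
Proof. by rewrite -(inj_eq (addIr y)) -addrA addrr_mod2 addr0 eq_sym add0r eq_sym. Qed.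

Definition artin_schreier : {set F} := [set u ^+ 2 + u | u : F].
Local Notation H := artin_schreier.

Lemma artin_schreierD s t : s \in H -> t \in H -> s + t \in H.
Proof.
case/imsetP=> u _ -> /imsetP[v _ ->]; apply/imsetP; exists (u + v) => //.
by apply: (@eq_mod2 (- (u * v))); ring.
Qed.

Lemma artin_schreierDr s t : s \in H -> (s + t \in H) = (t \in H).
Proof.
move=> sH; apply/idP/idP=> [/(artin_schreierD sH)|]; last exact: artin_schreierD.
by rewrite addrA addrr_mod2 add0r.
Qed.

(** u^2 + u = 1 would make u a primitive cube root of unity. *)
Lemma artin_schreier1 : 1 \notin H.
Proof.
apply/imsetP=> -[u _ u1]; have /eqP := no_primitive_cube_root u card_mod3; apply.
by rewrite -u1 addrr_mod2.
Qed.

Lemma artin_schreier_fiber u x : (x ^+ 2 + x == u ^+ 2 + u) = (x \in [set u; u + 1]).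
Proof.
rewrite -addr_eq0_mod2 !inE -!(addr_eq0_mod2 x) -mulf_eq0; congr (_ == 0).
by apply: (@eq_mod2 (- (x * u))); ring.
Qed.

Lemma card_artin_schreier : (#|H| * 2 = #|F|)%N.
Proof.
rewrite -sum_nat_const -[RHS]sum1_card [RHS](partition_big_imset (fun u => u ^+ 2 + u)) /=.
rewrite (_ : [set u ^+ 2 + u | u in _] = H) //; apply: eq_bigr => _ /imsetP[u _ ->].
rewrite (eq_bigl _ _ (artin_schreier_fiber u)) sum1_card cards2.
by rewrite -(inj_eq (addrI (- u))) addKr addNr eq_sym oner_eq0.
Qed.

Lemma artin_schreier_index2 s t : s \notin H -> t \notin H -> s + t \in H.
Proof.
move=> s'H t'H; have inj_s : injective (+%R s) by exact: addrI.
have disj : H :&: [set s + x | x in H] = set0.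
  apply/setP=> x; rewrite !inE; apply/andP=> -[xH /imsetP[y yH xE]].
  by move: xH; rewrite xE addrC artin_schreierDr // (negbTE s'H).
have : H :|: [set s + x | x in H] = setT.
  apply/eqP; rewrite eqEcard subsetT cardsU disj cards0 subn0 (card_imset _ inj_s).
  by rewrite cardsT -card_artin_schreier muln2 -addnn leqnn.
move/setP/(_ t); rewrite !inE (negbTE t'H) => /imsetP[x xH ->].
by rewrite addrA addrr_mod2 add0r.
Qed.

(** Substituting x = (b / a) u turns the equation into u^2 + u = a c / b^2. *)
Lemma card_roots_even a b c : a != 0 -> b != 0 ->
  #|quad_roots a b c| = ((a * c / b ^+ 2 \in H) * 2)%N.
Proof.
move=> a0 b0.
have rootE x : (a * x ^+ 2 + b * x + c == 0) = ((a * x / b) ^+ 2 + a * x / b == a * c / b ^+ 2).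
  rewrite -[RHS]addr_eq0_mod2.
  have -> : (a * x / b) ^+ 2 + a * x / b + a * c / b ^+ 2
     = a / b ^+ 2 * (a * x ^+ 2 + b * x + c) by field.
  by rewrite mulrI_eq0 //; apply: mulfI; rewrite mulf_neq0 ?invr_eq0 ?expf_neq0.
have [/imsetP[u _ Du]|no_root] := boolP (_ \in H); last first.
  apply: eq_card0 => x; rewrite inE rootE; apply: contraNF no_root => /eqP <-.
  exact: imset_f.
have -> : quad_roots a b c = [set b * u / a; b * (u + 1) / a].
  apply/setP=> x; rewrite inE rootE Du artin_schreier_fiber !inE.
  have eq_div v : (a * x / b == v) = (x == b * v / a).
    by apply/eqP/eqP=> [<-|->]; field; rewrite ?a0 ?b0.
  by rewrite !eq_div.
rewrite cards2 -subr_eq0 (_ : _ - _ = - (b / a)); last by field.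
by rewrite oppr_eq0 mulf_eq0 invr_eq0 (negbTE a0) (negbTE b0).
Qed.

Lemma coincidences_even b : b != 0 -> b + 1 != 0 ->
  coincidences 1 0 1 b = (((b^-1 \in H) + ((b + 1)^-1 \in H)) * 2)%N.
Proof.
move=> b0 b1; rewrite /coincidences mob_translate_eq // mob_translate_inv //.
have -> : - (b + 2%:R) = b by apply: (@eq_mod2 (- b - 1)); ring.
rewrite card_roots_even ?oner_neq0 // card_roots_even ?oppr_eq0 ?expf_neq0 //.
have -> : 1 * b / b ^+ 2 = b^-1 by field.
have -> : (b + 1) * (b ^+ 2 + 1) / (- (b + 1) ^+ 2) ^+ 2 = (b + 1)^-1.
  have -> : b ^+ 2 + 1 = (b + 1) ^+ 2 by apply: (@eq_mod2 (- b)); ring.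
  by rewrite sqrrN; field.
by rewrite mulnDl.
Qed.

(** For distinct nonzero s, u in H the hypothesis applied to s, s + u and then
    to 1/s + 1/(s + u) = u / (s (s + u)), which is in H since H has index 2,
    shows that s^2/u is not in H.  For two such elements s, t the sum
    (s + t)^2/u is in H, so the same statement for s + t leaves only
    s + t = u: besides 0 and u, the group H has at most two elements. *)
Lemma inverse_closed_bound :
  (forall s, s \in H -> s != 0 -> s^-1 \notin H) -> (#|H| <= 4)%N.
Proof.
move=> inv'H; rewrite leqNgt; apply/negP=> H5.
have quot s u : s \in H -> u \in H -> s != 0 -> u != 0 -> s != u -> s ^+ 2 / u \notin H.
  move=> sH uH s0 u0 su; have su0 : s + u != 0 by rewrite addr_eq0_mod2.
  have := artin_schreier_index2 (inv'H s sH s0) (inv'H _ (artin_schreierD sH uH) su0).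
  have -> : s^-1 + (s + u)^-1 = u / (s * (s + u)).
    by apply: (@eq_mod2 (s / (s * (s + u)))); field; rewrite s0 su0.
  move/inv'H; rewrite mulf_neq0 ?invr_eq0 ?mulf_neq0 // => /(_ isT).
  have -> : (u / (s * (s + u)))^-1 = s + s ^+ 2 / u by field; rewrite s0 su0 u0.
  by rewrite artin_schreierDr.
have sum_eq u s t : u \in H -> s \in H -> t \in H -> u != 0 -> s != 0 -> t != 0 ->
    s != u -> t != u -> s != t -> s + t = u.
  move=> uH sH tH u0 s0 t0 su tu st; apply/eqP.
  have := artin_schreier_index2 (quot s u sH uH s0 u0 su) (quot t u tH uH t0 u0 tu).
  have -> : s ^+ 2 / u + t ^+ 2 / u = (s + t) ^+ 2 / u.
    by apply: (@eq_mod2 (- (s * t / u))); field.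
  apply: contraTT => stu; apply: quot => //; first exact: artin_schreierD.
  by rewrite addr_eq0_mod2.
have [|u uH] := @exists_notin _ H [:: 0]; first exact: leq_trans H5.
rewrite !inE => u0.
have [|s sH] := @exists_notin _ H [:: 0; u]; first exact: leq_trans H5.
rewrite !inE negb_or => /andP[s0 su].
have [|t tH] := @exists_notin _ H [:: 0; u; s; u + s]; first exact: H5.
rewrite !inE !negb_or => /and4P[t0 tu ts /eqP[]].
rewrite -(sum_eq u s t) // 1?eq_sym //.
by rewrite addrAC addrr_mod2 add0r.
Qed.

(** Let h <> 0 be in H.  The value b = 1/h shows that the constant number of
    elements of H among 1/b and 1/(b + 1) is at least 1, and b = 1/(h + 1)
    shows that it is at most 1.  Their sum 1/(b^2 + b) is therefore never in
    H, and b^2 + b runs over H. *)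
Lemma uniform_even_bound :
  uniform_one_factorisation (complete3 (option F)) (mob_factorisation F) ->
  (#|F| <= 8)%N.
Proof.
move=> unif; rewrite leqNgt; apply/negP=> q8.
have one0 : 1 != 0 :> F := oner_neq0 F.
have const b c : b != 0 -> b != 1 -> c != 0 -> c != 1 ->
    ((b^-1 \in H) + ((b + 1)^-1 \in H) = (c^-1 \in H) + ((c + 1)^-1 \in H))%N.
  rewrite -!(addr_eq0_mod2 _ 1) => b0 b1 c0 c1.
  have := coincidences_uniform card_mod3 one0 one0 one0 one0
    (translate_neq b0 b1) (translate_neq c0 c1) unif.
  by rewrite !coincidences_even // => /eqP; rewrite eqn_pmul2r // => /eqP.
have H4 : (4 < #|H|)%N by rewrite -(ltn_pmul2r (isT : 0 < 2)%N) card_artin_schreier.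
have [|h hH] := @exists_notin _ H [:: 0]; first exact: leq_trans H4.
rewrite !inE => h0.
have h1 : h != 1 by apply: contraTneq hH => ->; exact: artin_schreier1.
have h1'H : h + 1 \notin H by rewrite artin_schreierDr // artin_schreier1.
have h10 : h + 1 != 0 by rewrite addr_eq0_mod2.
have h11 : h + 1 != 1 by rewrite -addr_eq0_mod2 -addrA addrr_mod2 addr0.
have xor b : b != 0 -> b != 1 -> ((b + 1)^-1 \in H) = (b^-1 \notin H).
  move=> b0 b1; have := const b h^-1 b0 b1; have := const b (h + 1)^-1 b0 b1.
  rewrite !invr_eq0 !invr_eq1 !invrK hH (negbTE h1'H) => /(_ h10 h11) + /(_ h0 h1).
  by do 4!case: (_ \in _).
have : (#|H| <= 4)%N; last by rewrite leqNgt H4.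
apply: inverse_closed_bound => s /imsetP[b _ ->] s0.
have b0 : b != 0 by apply: contraNneq s0 => ->; rewrite expr0n addr0.
have b1 : b != 1 by apply: contraNneq s0 => ->; rewrite expr1n addrr_mod2.
have b10 : b + 1 != 0 by rewrite addr_eq0_mod2.
have -> : (b ^+ 2 + b)^-1 = b^-1 + (b + 1)^-1.
  have -> : b ^+ 2 + b = b * (b + 1) by ring.
  by apply: (@eq_mod2 (- (b + 1)^-1)); field; rewrite b0 b10.
have := xor b b0 b1; case: (boolP (b^-1 \in H)) => [bH|b'H] /= b1H.
  by rewrite artin_schreierDr ?b1H.
by rewrite addrC artin_schreierDr ?b1H.
Qed.

End EvenCharacteristic.

(** * The orders 2, 5 and 8 *)

Lemma uniform_bound (F : finFieldType) : #|F| = 2 %[mod 3] ->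
  uniform_one_factorisation (complete3 (option F)) (mob_factorisation F) ->
  (#|F| <= 8)%N.
Proof.
move=> card_mod3; have [two0|two_neq0] := eqVneq (2%:R : F)%R 0%R.
  exact: uniform_even_bound.
by move=> unif; apply: leq_trans (uniform_odd_bound card_mod3 two_neq0 unif) _.
Qed.

Section SmallFields.

Variable F : finFieldType.
Hypothesis card_mod3 : #|F| = 2%N %[mod 3].
Implicit Types (a b c d x y z t : F) (p q r : option F) (M : hypergraph (option F)).
Local Open Scope ring_scope.
Local Notation C := (mob_factorisation F).

Lemma factors_disjoint M1 M2 : M1 \in C -> M2 \in C -> M1 != M2 -> [disjoint M1 & M2].
Proof.
move=> M1C M2C; apply: contraR => /pred0Pn[e /andP[/= eM1 eM2]].
by rewrite (factor_eq_of_edge card_mod3 M1C M2C eM1 eM2).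
Qed.

Lemma mob_union_connected M1 M2 : (#|F| <= 8)%N ->
  M1 \in C -> M2 \in C -> M1 != M2 -> hyper_connected (M1 :|: M2).
Proof.
move=> q8 M1C M2C neq12; have := mob_one_factorisation card_mod3.
case/andP=> _ /forall_inP fC; apply: small_union_connected; rewrite ?fC //.
  by rewrite card_option.
exact: factors_disjoint.
Qed.

Definition standard_pair y := mob_factor 1 0 :|: mob_factor y 0.

Lemma edge_third M e p q : M \in C -> e \in M -> p \in e -> q \in e -> p != q ->
  exists r, [/\ p != r, q != r & e = [set p; q; r]].
Proof.
move=> MC eM pe qe pq; have := mob_one_factorisation card_mod3.
case/andP=> _ /forall_inP/(_ M MC)/andP[/subsetP/(_ e eM)].
rewrite inE (cardsD1 p) pe (cardsD1 q) !inE [q == p]eq_sym pq qe !eqSS => /cards1P[r Dr] _.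
have re : r \in e :\ p :\ q by rewrite Dr set11.
move: re; rewrite !inE => /and3P[rq rp re]; exists r; rewrite ![_ == r]eq_sym; split=> //.
rewrite -(setD1K pe) -(setD1K (_ : q \in e :\ p)) ?Dr ?setUA //.
by rewrite !inE eq_sym pq.
Qed.

(** Two edges that share p and q are moved to {oo, 0, 1} and {oo, 0, y}, each of
    which lies in a unique factor. *)
Lemma adjacent_pair_iso M1 M2 p q :
    M1 \in C -> M2 \in C -> M1 != M2 -> p != q ->
    adjacent M1 p q -> adjacent M2 p q ->
  exists2 y, y != 0 /\ y != 1 & hyper_iso (M1 :|: M2) (standard_pair y).
Proof.
move=> M1C M2C neq12 pq /existsP[e /and3P[eM1 pe qe]] /existsP[f /and3P[fM2 pf qf]].
have [r [pr qr De]] := edge_third M1C eM1 pe qe pq.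
have [s [ps qs Df]] := edge_third M2C fM2 pf qf pq.
have [g pg [gp gq gr]] := preserves_3transitive card_mod3 pq pr qr.
case Ds: (g s) => [y|]; last by rewrite -gp in Ds; rewrite (perm_inj Ds) eqxx in ps.
have one0 : 1 != 0 :> F := oner_neq0 F.
have y0 : y != 0.
  by apply: contraNneq qs => y0; apply/eqP/(@perm_inj _ g); rewrite gq Ds y0.
have ge : standard_edge 1 \in hmap g M1.
  by rewrite -(mem_hmap g) De !imsetU !imset_set1 gp gq gr in eM1.
have gf : standard_edge y \in hmap g M2.
  by rewrite -(mem_hmap g) Df !imsetU !imset_set1 gp gq Ds in fM2.
exists y; first split=> //.
  apply: contraNneq neq12 => y1; rewrite y1 in gf.
  by apply/eqP/(@hmap_inj _ g)/(factor_eq_of_edge card_mod3 _ _ ge gf); exact: pg.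
exists g; rewrite -[LHS]/(hmap g _) hmapU.
by rewrite (standard_edge_factor one0 (pg _ M1C) ge) (standard_edge_factor y0 (pg _ M2C) gf).
Qed.

(** ** Order 5 *)

Lemma order5_factor M e : #|F| = 5%N -> M \in C -> e \in M -> M = [set e; ~: e].
Proof.
move=> q5 MC eM; have := mob_one_factorisation card_mod3.
case/andP=> _ /forall_inP/(_ M MC)/andP[/subsetP M3 /and3P[/eqP covM /trivIsetP trM _]].
have card3 f : f \in M -> #|f| = 3%N by move/M3; rewrite inE => /eqP.
have e'3 : #|~: e| = 3%N by rewrite cardsCs setCK card3 // card_option q5.
have other f : f \in M -> f != e -> f = ~: e.
  move=> fM fe; apply/eqP; rewrite eqEcard e'3 card3 // andbT.
  by rewrite -disjoints_subset trM.
have [u ue] : exists u, u \in ~: e by apply/card_gt0P; rewrite e'3.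
have /bigcupP[f fM uf] : u \in cover M by rewrite covM inE.
have fe : f != e by apply: contraTneq uf => ->; rewrite -in_setC.
have e'M : ~: e \in M by rewrite -(other f fM fe).
apply/setP=> h; rewrite !inE; apply/idP/orP => [hM|[] /eqP-> //].
by have [|he] := eqVneq h e; [left | right; rewrite (other h hM he)].
Qed.

(** A triple shares two vertices with one of two complementary triples. *)
Lemma order5_adjacent M1 M2 : #|F| = 5%N -> M1 \in C -> M2 \in C ->
  exists p q, [/\ p != q, adjacent M1 p q & adjacent M2 p q].
Proof.
move=> q5 M1C M2C.
have edge M : M \in C -> exists2 e, e \in M & #|e| = 3%N.
  case/mob_factorisationP=> a [b [a0 ->]]; exists (mob_edge a b None).
    by rewrite mob_factorE ?imset_f.
  exact: card_mob_edge.
have [e eM1 _] := edge _ M1C; have [f fM2 f3] := edge _ M2C.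
have [e' e'M1 big] : exists2 e', e' \in M1 & (1 < #|f :&: e'|)%N.
  have [?|small] := ltnP 1 #|f :&: e|; first by exists e.
  exists (~: e); first by rewrite (order5_factor q5 M1C eM1) !inE eqxx orbT.
  by move: (cardsID e f) small; rewrite setDE f3; lia.
have /card_gt1P[p [q [/setIP[pf pe] /setIP[qf qe] pq]]] := big.
by exists p, q; split=> //; apply/existsP; [exists e' | exists f]; apply/and3P.
Qed.

(** The transposition of y and z is not a projective map, but it preserves
    complements. *)
Lemma order5_standard_iso y z : #|F| = 5%N -> y != 0 -> y != 1 -> z != 0 -> z != 1 ->
  hyper_iso (standard_pair y) (standard_pair z).
Proof.
move=> q5 y0 y1 z0 z1; pose h := tperm (Some y) (Some z); exists h.
have one0 : 1 != 0 :> F := oner_neq0 F.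
have factorE x : x != 0 -> mob_factor x 0 = [set standard_edge x; ~: standard_edge x].
  by move=> x0; apply: order5_factor; rewrite ?mem_mob_factorisation ?mem_standard_edge.
have himage x x' : x != 0 -> x' != 0 -> h @: standard_edge x = standard_edge x' ->
    hmap h (mob_factor x 0) = mob_factor x' 0.
  move=> x0 x0' hx; rewrite !factorE // /hmap imsetU !imset_set1 hx; congr [set _; _].
  apply/setP=> p; rewrite -[p](permKV h) in_setC -hx !mem_imset ?in_setC //; exact: perm_inj.
rewrite -[LHS]/(hmap h _) hmapU !(himage 1 1, himage y z) //.
  by rewrite !imsetU !imset_set1 tpermL !tpermD // !(inj_eq Some_inj).
by rewrite !imsetU !imset_set1 !tpermD // !(inj_eq Some_inj).
Qed.

Lemma order5_uniform : #|F| = 5%N -> exists U : hypergraph (option F),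
  forall M1 M2, M1 \in C -> M2 \in C -> M1 != M2 -> hyper_iso (M1 :|: M2) U.
Proof.
move=> q5; have [|z _] := @exists_notin F setT [:: 0; 1]; first by rewrite cardsT q5.
rewrite !inE negb_or => /andP[z0 z1]; exists (standard_pair z) => M1 M2 M1C M2C neq12.
have [p [q [pq adj1 adj2]]] := order5_adjacent q5 M1C M2C.
have [y [y0 y1] iso] := adjacent_pair_iso M1C M2C neq12 pq adj1 adj2.
exact: hyper_iso_trans iso (order5_standard_iso q5 y0 y1 z0 z1).
Qed.

(** ** Order 8 *)

Lemma order8_two0 : #|F| = 8%N -> 2%:R = 0 :> F.
Proof. by move=> q8; have /andP[_ /eqP] := @card_finPcharP F 2 3 q8 isT. Qed.

(** Over the field with two elements, x^8 - x is the product of these factors. *)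
Lemma order8_cases x : #|F| = 8%N ->
  [|| x == 0, x == 1, x ^+ 3 + x + 1 == 0 | x ^+ 3 + x ^+ 2 + 1 == 0].
Proof.
move=> q8; have two0 := order8_two0 q8.
have : x * (x - 1) * (x ^+ 3 + x + 1) * (x ^+ 3 + x ^+ 2 + 1) = x ^+ 8 - x.
  by apply: (@eq_mod2 _ two0 (x ^+ 5 - x ^+ 4)); ring.
rewrite -q8 expf_card subrr => /eqP.
by rewrite !mulf_eq0 subr_eq0 -!orbA.
Qed.

Lemma order8_sqrt x : #|F| = 8%N -> (x ^+ 4) ^+ 2 = x.
Proof. by move=> q8; rewrite -exprM -[(4 * 2)%N]/8%N -q8 expf_card. Qed.

(** The fixed points of the composite are the roots of
    (b + 1) x^2 + k x + (a + b), and t = k / a is the trace of the product of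
    the two matrices scaled to determinant 1.  Such a quadratic has
    a root if t = 0, squaring being onto, and if t^3 + t^2 + 1 = 0, since
    then 1/t = t^2 + t. *)
Lemma order8_coincidence a b : #|F| = 8%N -> a != 0 ->
    let k := 1 + (a ^+ 2 + a * b + b ^+ 2) + a + b in
    k = 0 \/ k ^+ 3 + a * k ^+ 2 + a ^+ 3 = 0 ->
  exists p, mob 1 0 (mob a b p) = p.
Proof.
move=> q8 a0 k k_root; have two0 := order8_two0 q8.
have [b1|b1] := eqVneq b 1; first by exists None; rewrite /= b1 addr0 eqxx.
have b10 : b + 1 != 0 by rewrite addr_eq0_mod2.
have [x x_root] : exists x, (b + 1) * x ^+ 2 + k * x + (a + b) = 0.
  case: k_root => [->|k_root].
    exists (((a + b) / (b + 1)) ^+ 4); rewrite mul0r addr0 order8_sqrt //.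
    by rewrite mulrC divfK // (addrr_mod2 two0).
  (* x = k u / (b + 1) turns the equation into u^2 + u = 1/k + 1/k^2 + 1/t^2
     for t = k / a; as 1/t = t^2 + t, a solution is u = 1/k + t^2 *)
  exists ((1 + k ^+ 3 / a ^+ 2) / (b + 1)).
  have kE : a + b = (k - 1 - a ^+ 2) / (b + 1) by rewrite /k; field.
  rewrite kE; clearbody k.
  rewrite -(mul0r ((k ^+ 3 + a * k ^+ 2 + a ^+ 3) / (a ^+ 4 * (b + 1)))) -{1}k_root.
  apply: (@eq_mod2 _ two0 ((a ^+ 2 * k ^+ 3 + k * a ^+ 4 - a ^+ 6 - a * k ^+ 5
    - a ^+ 3 * k ^+ 3 - a ^+ 4 * k ^+ 2) / (a ^+ 4 * (b + 1)))).
  by field; rewrite b10 a0.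
exists (Some x); rewrite [mob a b _]/=; have [xE|x_ab] := eqVneq x (a + b).
  have : x * a ^+ 2 = 0.
    by rewrite -x_root; apply: (@eq_mod2 _ two0 (x * a ^+ 2 - x * k)); rewrite /k xE; ring.
  by move/eqP; rewrite mulf_eq0 expf_eq0 (negbTE a0) andbF orbF => /eqP->.
have d0 : a + b - x != 0 by rewrite subr_eq0 eq_sym.
set y := b + _; have xy : x * (1 - y) = 1.
  rewrite -[RHS]addr0 -(mul0r (a + b - x)^-1) -x_root.
  apply: (@eq_mod2 _ two0
    (- (x ^+ 2 + x * (a * b + b ^+ 2 + a ^+ 2) + (a + b)) / (a + b - x))).
  by rewrite /y /k; field.
have y1 : 1 - y != 0 by apply: contra_eq_neq xy => ->; rewrite mulr0 eq_sym oner_neq0.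
rewrite /= addr0 -[y == 1]subr_eq0 -oppr_eq0 opprB (negbTE y1) add0r expr1n div1r.
by congr Some; apply: (mulIf y1); rewrite xy mulVf.
Qed.

(** After moving the first factor to that of [mob 1 0], the trace t of
    [order8_coincidence] becomes t + 1 if the second map is replaced by its
    inverse, and one of t and t + 1 always satisfies its condition. *)
Lemma order8_adjacent M1 M2 : #|F| = 8%N -> M1 \in C -> M2 \in C ->
  exists p q, [/\ p != q, adjacent M1 p q & adjacent M2 p q].
Proof.
move=> q8 M1C M2C; have two0 := order8_two0 q8; have one0 : 1 != 0 :> F := oner_neq0 F.
have [p [q [r [pq pr qr eM1]]]] : exists p q r, [/\ p != q, p != r, q != r & [set p; q; r] \in M1].
  case/mob_factorisationP: M1C => a [b [a0 ->]]; have := mem_mob_factorisation b a0.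
  have : mob_edge a b None \in mob_factor a b by rewrite mob_factorE ?imset_f.
  move=> eM MC; have [p [q [r [pq pr qr De]]]] := mob_factor_edges card_mod3 MC eM.
  by exists p, q, r; split=> //; rewrite -De.
have [g pg ge] := standard_edge_image card_mod3 pq pr qr.
have gM1 : hmap g M1 = mob_factor 1 0.
  by apply: (standard_edge_factor one0); rewrite ?pg // -ge mem_hmap.
have /mob_factorisationP[a [b [a0 gM2]]] := pg M2 M2C.
suff [u [v [uv adj1 adj2]]] : exists u v,
    [/\ u != v, adjacent (mob_factor 1 0) u v & adjacent (mob_factor a b) u v].
  exists ((g^-1)%g u), ((g^-1)%g v); rewrite (inj_eq perm_inj) uv.
  by split=> //; rewrite -(adjacent_hmap g) !permKV ?gM1 ?gM2.
have from_coincidence a' b' w : a' != 0 -> mob_factor a' b' = mob_factor a b ->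
    mob 1 0 (mob a' b' w) = w -> exists u v,
    [/\ u != v, adjacent (mob_factor 1 0) u v & adjacent (mob_factor a b) u v].
  move=> a0' <- w_fix; exists (mob a' b' w), w; split; first exact: mob_neq.
    by rewrite adjacent_mob // !inE w_fix eqxx !orbT.
  by rewrite adjacent_mob // !inE mobK3 // eqxx !orbT.
pose k := 1 + (a ^+ 2 + a * b + b ^+ 2) + a + b.
pose k' := 1 + ((- a) ^+ 2 + - a * (a + b) + (a + b) ^+ 2) + - a + (a + b).
have kk' : k' / a = k / a + 1.
  by apply: (@eq_mod2 _ two0 (- 1)); rewrite /k /k'; field.
have root_scale c : (c / a) ^+ 3 + (c / a) ^+ 2 + 1 = 0 -> c ^+ 3 + a * c ^+ 2 + a ^+ 3 = 0.
  by move=> c_root; rewrite -(mulr0 (a ^+ 3)) -c_root; field.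
have a0' : - a != 0 by rewrite oppr_eq0.
have use_k : k = 0 \/ k ^+ 3 + a * k ^+ 2 + a ^+ 3 = 0 -> exists u v,
    [/\ u != v, adjacent (mob_factor 1 0) u v & adjacent (mob_factor a b) u v].
  by move/(order8_coincidence q8 a0) => [w]; exact: from_coincidence.
have use_k' : k' = 0 \/ k' ^+ 3 + a * k' ^+ 2 + a ^+ 3 = 0 -> exists u v,
    [/\ u != v, adjacent (mob_factor 1 0) u v & adjacent (mob_factor a b) u v].
  move=> k'_root; have [|w] := @order8_coincidence (- a) (a + b) q8 a0'; last first.
    by apply: from_coincidence; rewrite ?mob_factor_opp.
  rewrite -/k'; case: k'_root => [|k'_root]; [by left | right].
  by rewrite -k'_root; apply: (@eq_mod2 _ two0 (- (a * k' ^+ 2) - a ^+ 3)); ring.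
have div0 c : c / a = 0 -> c = 0.
  by move/eqP; rewrite mulf_eq0 invr_eq0 (negbTE a0) orbF => /eqP.
case/or4P: (order8_cases (k / a) q8) => /eqP ka.
- by apply: use_k; left; exact: div0.
- by apply: use_k'; left; apply: div0; rewrite kk' ka (addrr_mod2 two0).
- apply: use_k'; right; apply: root_scale; rewrite kk' -ka.
  by apply: (@eq_mod2 _ two0 (2%:R * (k / a) ^+ 2 + 2%:R * (k / a) + 1)); ring.
- by apply: use_k; right; exact: root_scale.
Qed.

Definition frobenius p : option F := omap (fun y => y ^+ 2) p.

Lemma frobenius_inj : 2%:R = 0 :> F -> injective frobenius.
Proof.
move=> two0 [x|] [y|] //= [] /eqP; rewrite -(addr_eq0_mod2 two0).
have -> : x ^+ 2 + y ^+ 2 = (x + y) ^+ 2 by apply: (@eq_mod2 _ two0 (- (x * y))); ring.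
by rewrite expf_eq0 /= addr_eq0_mod2 // => /eqP->.
Qed.

Lemma hmap_frobenius (two0 : 2%:R = 0 :> F) a b : a != 0 ->
  hmap (perm (frobenius_inj two0)) (mob_factor a b) = mob_factor (a ^+ 2) (b ^+ 2).
Proof.
move=> a0; apply: hmap_mob; rewrite ?expf_neq0 // => -[y|]; rewrite !permE //=.
have sqrD u v : (u + v) ^+ 2 = u ^+ 2 + v ^+ 2 :> F.
  by apply: (@eq_mod2 _ two0 (u * v)); ring.
have inj_sqr : injective (fun u : F => u ^+ 2).
  by move=> u v eq_uv; have [] := @frobenius_inj two0 (Some u) (Some v) (congr1 Some eq_uv).
rewrite -sqrD (inj_eq inj_sqr); have [//|yab] := eqVneq y (a + b); congr Some.
rewrite [LHS]sqrD expr_div_n; congr (_ + _ / _).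
by apply: (@eq_mod2 _ two0 (y ^+ 2 - y * (a + b))); ring.
Qed.

Lemma standard_pair_frobenius y : 2%:R = 0 :> F -> y != 0 ->
  hyper_iso (standard_pair y) (standard_pair (y ^+ 2)).
Proof.
move=> two0 y0; exists (perm (frobenius_inj two0)); rewrite -[LHS]/(hmap _ _) hmapU.
by rewrite !hmap_frobenius ?oner_neq0 // expr1n expr0n.
Qed.

(** Scaling by 1/y exchanges the roles of the two factors. *)
Lemma standard_pair_inv y : y != 0 -> hyper_iso (standard_pair y) (standard_pair y^-1).
Proof.
move=> y0; have y0' : y^-1 != 0 by rewrite invr_eq0.
exists (affine_perm 0 y0'); rewrite -[LHS]/(hmap _ _) hmapU !hmap_affine ?oner_neq0 //.
by rewrite mulr1 mulVf // mulr0 addr0 setUC.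
Qed.

(** The two cubics are reciprocal, and the Frobenius map permutes the three
    roots t, t^2, t^4 of x^3 + x + 1. *)
Lemma order8_uniform : #|F| = 8%N -> exists U : hypergraph (option F),
  forall M1 M2, M1 \in C -> M2 \in C -> M1 != M2 -> hyper_iso (M1 :|: M2) U.
Proof.
move=> q8; have two0 := order8_two0 q8.
have normalise y : y != 0 -> y != 1 -> exists2 t, t ^+ 3 + t + 1 = 0 &
    hyper_iso (standard_pair y) (standard_pair t).
  move=> y0 y1; have := order8_cases y q8; rewrite (negbTE y0) (negbTE y1) /=.
  case/orP=> /eqP y_root; first by exists y => //; exact: hyper_iso_refl.
  exists y^-1; last exact: standard_pair_inv.
  by rewrite -(mulr0 (y^-1 ^+ 3)) -y_root; field.
have [|z _] := @exists_notin F setT [:: 0; 1]; first by rewrite cardsT q8.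
rewrite !inE negb_or => /andP[z0 z1]; have [t t_root _] := normalise z z0 z1.
have t0 : t != 0.
  by apply: contra_eq_neq t_root => ->; rewrite expr0n !add0r oner_neq0.
exists (standard_pair t) => M1 M2 M1C M2C neq12.
have [p [q [pq adj1 adj2]]] := order8_adjacent q8 M1C M2C.
have [y [y0 y1] iso] := adjacent_pair_iso M1C M2C neq12 pq adj1 adj2.
have [s s_root iso_s] := normalise y y0 y1.
apply: hyper_iso_trans iso _; apply: hyper_iso_trans iso_s _.
have t8 : (t ^+ 4) ^+ 2 = t by exact: order8_sqrt.
have iso4 : hyper_iso (standard_pair (t ^+ 4)) (standard_pair t).
  by rewrite -{2}t8; apply: standard_pair_frobenius; rewrite ?expf_neq0.
have iso2 : hyper_iso (standard_pair (t ^+ 2)) (standard_pair t).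
  apply: hyper_iso_trans iso4; rewrite (_ : t ^+ 4 = (t ^+ 2) ^+ 2); last by rewrite -exprM.
  by apply: standard_pair_frobenius; rewrite ?expf_neq0.
have /eqP : (s + t) * (s + t ^+ 2) * (s + t ^+ 4) = 0.
  rewrite -s_root -[RHS]addr0.
  rewrite -(mul0r (s ^+ 2 * t + s * (t ^+ 3 + t ^+ 2 + t + 1) + (t ^+ 4 + t ^+ 2 + t + 1))).
  rewrite -t_root; apply: (@eq_mod2 _ two0 (- (s * (t ^+ 4 + t ^+ 3 + t ^+ 2 + t + 1)
    + (t ^+ 5 + t ^+ 4 + t ^+ 3 + t ^+ 2 + t + 1)))).
  by ring.
rewrite !mulf_eq0 !(addr_eq0_mod2 two0) => /orP[/orP[]|] /eqP -> //.
exact: hyper_iso_refl.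
Qed.

(** The whole vertex set is the only triple. *)
Lemma order2_eq M1 M2 : #|F| = 2%N -> M1 \in C -> M2 \in C -> M1 = M2.
Proof.
move=> q2 M1C M2C; have := mob_one_factorisation card_mod3.
case/andP=> _ /forall_inP fC.
have single M e : M \in C -> e \in M -> e = setT.
  move=> MC eM; apply/eqP; rewrite eqEcard subsetT cardsT card_option q2.
  by have /andP[/subsetP/(_ e eM)] := fC M MC; rewrite inE => /eqP->.
have full M : M \in C -> setT \in M.
  case/mob_factorisationP=> a [b [a0 DM]].
  have eM : mob_edge a b None \in M by rewrite DM mob_factorE ?imset_f.
  by rewrite -(single M _ _ eM) // DM mem_mob_factorisation.
exact: (factor_eq_of_edge card_mod3 M1C M2C (full _ M1C) (full _ M2C)).
Qed.

End SmallFields.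

Theorem theorem1p2 (F : finFieldType) (q : nat)
    (cardF : #|F| = q) (hq : q = 2 %[mod 3]) :
  (uniform_one_factorisation (complete3 (option F)) (mob_factorisation F)
     <-> q \in [:: 2; 5; 8])
  /\ (q \in [:: 2; 5; 8] ->
      uniform_connected_one_factorisation (complete3 (option F))
        (mob_factorisation F)).
Proof.
move: hq; rewrite -{}cardF => card_mod3.
have unif : #|F| \in [:: 2; 5; 8] ->
    uniform_one_factorisation (complete3 (option F)) (mob_factorisation F).
  move=> small; split; first exact: mob_one_factorisation.
  case/or3P: small => [/eqP q2|/eqP q5|]; last 1 first.
  - by rewrite orbF => /eqP q8; exact: order8_uniform.
  - by exists set0 => M1 M2 M1C M2C; rewrite (order2_eq card_mod3 q2 M1C M2C) eqxx.
  - exact: order5_uniform.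
split; first split=> // /(uniform_bound card_mod3).
  by move: #|F| card_mod3; do 9!case=> //.
move=> small; split; first exact: unif.
move=> M1 M2; apply: mob_union_connected => //.
by move: small; rewrite !inE => /or3P[] /eqP->.
Qed.
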